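(* Let $n\ge 2$ and let $0<c<1$. There is a constant $\kappa>0$, depending only on $n$ and $c$, such that the following holds. Let $r>0$, let $x_0\in\mathbb{H}^n$, and let $P\subset\mathbb{H}^n$ be a convex polytope such that the Hausdorff distance between the boundary $\partial P$ and the sphere $S(x_0,r)$ of radius $r$ around $x_0$ is at most $c\,r$. Then the number of vertices of $P$ and the number of top-dimensional faces of $P$ are both at least $\exp(\kappa r)$.
   Context: $\mathbb{H}^n$ is hyperbolic $n$-space, and $S(x_0,r)=\{y\in\mathbb{H}^n : d(x_0,y)=r\}$ where $d$ is hyperbolic distance. A convex polytope $P\subset\mathbb{H}^n$ is an $n$-dimensional convex polytope with finitely many faces and no hyperideal vertices, i.e. the hyperbolic convex hull (with nonempty interior) of finitely many points of $\mathbb{H}^n\cup\partial\mathbb{H}^n$. Hausdorff distance is taken with respect to the hyperbolic metric. *)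

(* Defs.v *)
From HB Require Import structures.
From mathcomp Require Import all_boot all_order all_algebra finmap.
From mathcomp Require Import all_classical all_reals all_analysis.
From mathcomp Require Import ring lra.

Set Implicit Arguments.
Unset Strict Implicit.
Unset Printing Implicit Defensive.

Import Order.TTheory GRing.Theory Num.Theory.
Import numFieldTopology.Exports numFieldNormedType.Exports.

Local Open Scope classical_set_scope.
Local Open Scope ring_scope.

(* Hyperbolic n-space is the upper sheet of the hyperboloid in R^(n+1);
   coordinate 0 is the time coordinate. *)
Definition lorentz (R : realType) (n : nat) (x y : 'rV[R]_n.+1) : R :=
  \sum_(i < n) x 0 (lift ord0 i) * y 0 (lift ord0 i) - x 0 0 * y 0 0.

Definition hyperboloid (R : realType) (n : nat) : pred 'rV[R]_n.+1 :=
  fun x => (lorentz x x == -1) && (0 < x 0 0).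

Record hyp (R : realType) (n : nat) :=
  Hyp { hval :> 'rV[R]_n.+1 ; hvalP : hyperboloid hval }.
Arguments hval {R n} _.

HB.instance Definition _ (R : realType) (n : nat) := [isSub for @hval R n].
HB.instance Definition _ (R : realType) (n : nat) := [Choice of hyp R n by <:].

Definition arcosh (R : realType) (x : R) : R := ln (x + Num.sqrt (x ^+ 2 - 1)).

Definition hdist (R : realType) (n : nat) (x y : hyp R n) : R :=
  arcosh (- lorentz x y).

Section hyperbolic_metric.
Context {R : realType} {n : nat}.
Implicit Types (x y z : 'rV[R]_n.+1) (a b c : hyp R n).

Lemma lorentzC x y : lorentz x y = lorentz y x.
Proof.
by rewrite /lorentz mulrC; congr (_ - _); apply: eq_bigr => i _; rewrite mulrC.
Qed.

Lemma lorentzDl x y z : lorentz (x + y) z = lorentz x z + lorentz y z.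
Proof.
rewrite /lorentz !mxE mulrDl opprD addrACA -big_split /=; congr (_ + _).
by apply: eq_bigr => i _; rewrite !mxE mulrDl.
Qed.

Lemma lorentzZl k x z : lorentz (k *: x) z = k * lorentz x z.
Proof.
rewrite /lorentz !mxE mulrBr mulr_sumr mulrA; congr (_ - _).
by apply: eq_bigr => i _; rewrite !mxE mulrA.
Qed.

Lemma lorentzDr x y z : lorentz z (x + y) = lorentz z x + lorentz z y.
Proof. by rewrite lorentzC lorentzDl !(lorentzC z). Qed.

Lemma lorentzZr k x z : lorentz z (k *: x) = k * lorentz z x.
Proof. by rewrite lorentzC lorentzZl lorentzC. Qed.

Let discr (p q s : R) : 0 <= p -> 0 <= s ->
  (forall t, 0 <= p + t * q *+ 2 + t ^+ 2 * s) -> q ^+ 2 <= p * s.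
Proof.
move=> p0 s0 h; have [s_eq0|sN0] := eqVneq s 0; last first.
  have sP : 0 < s by rewrite lt_def sN0.
  have := h (- q / s).
  have -> : p + - q / s * q *+ 2 + (- q / s) ^+ 2 * s = (p * s - q ^+ 2) / s.
    by field.
  by rewrite pmulr_lge0 ?invr_gt0// subr_ge0.
have [->|qN0] := eqVneq q 0; first by rewrite expr0n mulr_ge0.
have := h (- (p + 1) / (q *+ 2)); rewrite s_eq0 mulr0 addr0.
have -> : p + - (p + 1) / (q *+ 2) * q *+ 2 = -1 by field.
by rewrite ler0N1.
Qed.

Let sp x y := \sum_(i < n) x 0 (lift ord0 i) * y 0 (lift ord0 i).

Let sp_ge0 x : 0 <= sp x x.
Proof. by apply: sumr_ge0 => i _; rewrite -expr2 sqr_ge0. Qed.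

Let sp_CS x y : sp x y ^+ 2 <= sp x x * sp y y.
Proof.
apply: discr => // t; suff -> : sp x x + t * sp x y *+ 2 + t ^+ 2 * sp y y =
  sp (x + t *: y) (x + t *: y) by [].
rewrite /sp -mulrnAr -sumrMnl !mulr_sumr -!big_split /=; apply: eq_bigr => i _.
by rewrite !mxE; ring.
Qed.

Let lorentzE x y : lorentz x y = sp x y - x 0 0 * y 0 0. Proof. by []. Qed.

Let hypE a : sp a a = a 0 0 ^+ 2 - 1.
Proof. by have /andP[/eqP + _] := hvalP a; rewrite lorentzE expr2; lra. Qed.

Let hyp_gt0 a : 0 < a 0 0. Proof. by have /andP[] := hvalP a. Qed.

Lemma lorentzxx a : lorentz a a = -1.
Proof. by have /andP[/eqP] := hvalP a. Qed.

Let lorentz_orth a y : lorentz y a = 0 ->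
  sp y y <= a 0 0 ^+ 2 * lorentz y y.
Proof.
move=> ya; have := sp_CS y a; rewrite hypE.
have -> : sp y a = y 0 0 * a 0 0 by move: ya; rewrite lorentzE; lra.
by rewrite lorentzE => h; nra.
Qed.

Lemma lorentz_orth_ge0 a y : lorentz y a = 0 -> 0 <= lorentz y y.
Proof.
move=> /lorentz_orth h; have := le_trans (sp_ge0 y) h.
by rewrite pmulr_rge0// exprn_gt0.
Qed.

Lemma lorentz_orth_CS a y z : lorentz y a = 0 -> lorentz z a = 0 ->
  lorentz y z ^+ 2 <= lorentz y y * lorentz z z.
Proof.
move=> ya za; apply: discr; [exact: lorentz_orth_ge0 ya|exact: lorentz_orth_ge0 za|].
move=> t; have : lorentz (y + t *: z) a = 0.
  by rewrite lorentzDl lorentzZl ya za mulr0 addr0.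
move/lorentz_orth_ge0; rewrite !(lorentzDl, lorentzDr, lorentzZl, lorentzZr).
by rewrite (lorentzC z y) => /le_trans; apply; rewrite le_eqVlt; apply/orP; left;
  apply/eqP; ring.
Qed.

Lemma lorentz_hyp_ge1 a b : 1 <= - lorentz a b.
Proof.
have := sp_CS a b; rewrite !hypE lorentzE.
have := hyp_gt0 a; have := hyp_gt0 b.
have := sp_ge0 a; have := sp_ge0 b; rewrite !hypE.
move: (sp a b) (hval a 0 0) (hval b 0 0) => s p q hq hp q0 p0 h.
have p1 : 1 <= p by nra.
have q1 : 1 <= q by nra.
have pq1 : 1 <= p * q by nra.
rewrite opprB lerBrDr -lerBrDl.
apply: (@le_trans _ _ `|s|); first exact: ler_norm.
have h1 : 0 <= p * q - 1 by lra.
rewrite -(ger0_norm h1) -ler_sqr ?nnegrE// !real_normK ?num_real//.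
apply: (le_trans h).
by have := sqr_ge0 (p - q); nra.
Qed.

Let proj a b := hval a + lorentz a b *: hval b.

Let proj_orth a b : lorentz (proj a b) b = 0.
Proof. by rewrite lorentzDl lorentzZl lorentzxx; ring. Qed.

Lemma hyp_eqP a b : - lorentz a b = 1 -> a = b.
Proof.
move=> ab; have o := proj_orth a b.
have pE : proj a b = hval a - hval b.
  by rewrite /proj -[lorentz a b]opprK ab scaleN1r.
have l0 : lorentz (proj a b) (proj a b) = 0.
  rewrite /proj !(lorentzDl, lorentzDr, lorentzZl, lorentzZr) !lorentzxx.
  rewrite (lorentzC b a).
  by have -> : lorentz a b = -1; [lra|ring].
have := lorentz_orth o; rewrite l0 mulr0 => s0.
have {}s0 : sp (proj a b) (proj a b) = 0 by apply/eqP; rewrite eq_le s0 sp_ge0.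
have z i : proj a b 0 (lift ord0 i) = 0.
  move/eqP: s0; rewrite /sp psumr_eq0; last by move=> j _; rewrite -expr2 sqr_ge0.
  by move/allP => /(_ i (mem_index_enum _)); rewrite mulf_eq0 orbb => /eqP.
have z0 : proj a b 0 0 = 0.
  move: o; rewrite lorentzE /sp big1 => [|i _]; last by rewrite z mul0r.
  by rewrite sub0r => /eqP; rewrite oppr_eq0 mulf_eq0 (gt_eqF (hyp_gt0 b)) orbF => /eqP.
have ab0 : proj a b = 0.
  apply/rowP => j; case: (unliftP ord0 j) => [i ->|->].
    by rewrite z mxE.
  by rewrite z0 mxE.
by apply: val_inj => /=; apply/eqP; rewrite -subr_eq0 -pE ab0.
Qed.

Let sq (x : R) := Num.sqrt (x ^+ 2 - 1).

Let sqE (x : R) : 1 <= x -> sq x ^+ 2 = x ^+ 2 - 1.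
Proof. by move=> x1; rewrite sqr_sqrtr//; nra. Qed.

Let arg_gt0 (x : R) : 1 <= x -> 0 < x + sq x.
Proof. by move=> x1; rewrite ltr_wpDr ?sqrtr_ge0//; lra. Qed.

Let hdistxx a : hdist a a = 0.
Proof.
by rewrite /hdist lorentzxx opprK /arcosh expr1n subrr sqrtr0 addr0 ln1.
Qed.

Let hdist_sym a b : hdist a b = hdist b a.
Proof. by rewrite /hdist lorentzC. Qed.

Let hdist_positivity a b : hdist a b = 0 -> a = b.
Proof.
move=> h; apply: hyp_eqP; have ab1 := lorentz_hyp_ge1 a b.
have := lnK (arg_gt0 ab1); move: h; rewrite /hdist /arcosh -/(sq _) => ->.
rewrite expR0 => e; have : 0 <= sq (- lorentz a b) by exact: sqrtr_ge0.
by lra.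
Qed.

Let hdist_triangle b a c : hdist a c <= hdist a b + hdist b c.
Proof.
have ab1 := lorentz_hyp_ge1 a b; have bc1 := lorentz_hyp_ge1 c b.
have ac1 := lorentz_hyp_ge1 a c.
have := lorentz_orth_CS (proj_orth a b) (proj_orth c b).
rewrite /proj !(lorentzDl, lorentzDr, lorentzZl, lorentzZr) !lorentzxx.
rewrite !(lorentzC b) => CS.
rewrite (hdist_sym b c) /hdist /arcosh -!/(sq _) -lnM ?posrE ?arg_gt0//.
rewrite ler_ln ?posrE ?mulr_gt0 ?arg_gt0//.
move: CS ab1 bc1 ac1.
move: (lorentz a b) (lorentz c b) (lorentz a c) => p q s CS p1 q1 s1.
have {CS} CS : (p * q + s) ^+ 2 <= (p ^+ 2 - 1) * (q ^+ 2 - 1).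
  by apply: le_trans (le_trans CS _); rewrite le_eqVlt; apply/orP; left;
    apply/eqP; ring.
have := sqE p1; have := sqE q1; have := sqE s1; rewrite !sqrrN.
have : 0 <= sq (- p) by exact: sqrtr_ge0.
have : 0 <= sq (- q) by exact: sqrtr_ge0.
have : 0 <= sq (- s) by exact: sqrtr_ge0.
move: (sq (- p)) (sq (- q)) (sq (- s)) => u v w w0 v0 u0 wE vE uE.
have D : - s <= p * q + u * v.
  rewrite -uE -vE -exprMn in CS.
  have := CS; rewrite -ler_sqrt ?sqr_ge0// !sqrtr_sqr (ger0_norm (mulr_ge0 u0 v0)).
  by rewrite -normrN => /(le_trans (ler_norm _)); lra.
have E : w <= - p * v - q * u.
  have e0 : 0 <= - p * v - q * u by nra.
  rewrite -ler_sqr ?nnegrE// wE.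
  have -> : (- p * v - q * u) ^+ 2 = (p * q + u * v) ^+ 2 - 1.
    have -> : (- p * v - q * u) ^+ 2 =
      p ^+ 2 * v ^+ 2 + q ^+ 2 * u ^+ 2 + p * q * u * v *+ 2 by ring.
    have -> : (p * q + u * v) ^+ 2 =
      p ^+ 2 * q ^+ 2 + u ^+ 2 * v ^+ 2 + p * q * u * v *+ 2 by ring.
    by rewrite uE vE; ring.
  by rewrite lerB// -sqrrN ler_sqr ?nnegrE//; lra.
by lra.
Qed.

HB.instance Definition _ := @isMetric.Build R (hyp R n) (@hdist R n)
  hdistxx hdist_positivity hdist_sym hdist_triangle.

End hyperbolic_metric.

Section polytopes.
Context {R : realType} {n : nat}.
Implicit Types (P : set (hyp R n)) (C V F : set 'rV[R]_n.+1).

(* A point of the sphere at infinity is a future light ray, represented by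
   its vector with time coordinate 1. *)
Definition ideal : set 'rV[R]_n.+1 :=
  [set x | lorentz x x = 0 /\ x 0 0 = 1].

Definition hyp_bar : set 'rV[R]_n.+1 := [set` @hyperboloid R n] `|` ideal.

(* The geodesic joining two points is the trace of the plane spanned by them. *)
Definition geodesic (p q : 'rV[R]_n.+1) : set 'rV[R]_n.+1 :=
  [set z | hyp_bar z /\
     exists s t : R, [/\ 0 <= s, 0 <= t & z = s *: p + t *: q]].

Definition hconvex C :=
  C `<=` hyp_bar /\ forall p q, C p -> C q -> geodesic p q `<=` C.

Definition hconvex_hull V : set 'rV[R]_n.+1 := smallest hconvex V.

Definition convex_polytope P :=
  P° !=set0 /\
  exists V, [/\ finite_set V, V `<=` hyp_bar &
                P = [set x | hconvex_hull V (hval x)]].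

(* Closure of P in the compactification hyp_bar. Its topology is that of the
   closed ball, seen in the chart x |-> x / x_0 (the projective model), which
   fixes the chosen representatives of the points at infinity. *)
Definition hyp_closure P : set 'rV[R]_n.+1 :=
  hval @` closure P `|`
  ideal `&` closure [set (hval x 0 0)^-1 *: hval x | x in P].

(* Hyperplanes and half-spaces of hyperbolic space are cut out by the linear
   forms lorentz u, with u spacelike. *)
Definition face P F :=
  exists u : 'rV[R]_n.+1, [/\ 0 < lorentz u u,
    forall x, hyp_closure P x -> lorentz u x <= 0 &
    F = hyp_closure P `&` [set x | lorentz u x = 0]].

(* F has dimension k if the least k-plane containing it has dimension k; a
   k-plane is the trace of a linear subspace of dimension k + 1. *)
Definition has_hdim F (k : nat) :=
  exists M : 'M[R]_(k.+1, n.+1), [/\ row_free M,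
    forall i, F (row i M) & forall x, F x -> (x <= M)%MS].

(* Ideal vertices are included. *)
Definition vertices P : set 'rV[R]_n.+1 := [set v | face P [set v]].

Definition facets P : set (set 'rV[R]_n.+1) :=
  [set F | face P F /\ has_hdim F n.-1].

End polytopes.

Definition boundary (T : topologicalType) (A : set T) : set T :=
  closure A `\` A°.

Definition sphere (R : realType) (T : metricType R) (x : T) (r : R) : set T :=
  [set y | mdist x y = r].

Definition hausdorff_distance (R : realType) (T : metricType R)
    (A B : set T) : \bar R :=
  maxe (ereal_sup [set edist_inf B a | a in A])
       (ereal_sup [set edist_inf A b | b in B]).

(* The number of elements of a finite set; fset_set sends infinite sets to the
   empty set. *)
Definition card_of (T : choiceType) (A : set T) : nat := #|` fset_set A|.

(* Main.v *)
Require Import Defs.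
From HB Require Import structures.
From mathcomp Require Import all_boot all_order all_algebra finmap.
From mathcomp Require Import all_classical all_reals all_analysis.
From mathcomp Require Import ring lra.

Set Implicit Arguments.
Unset Strict Implicit.
Unset Printing Implicit Defensive.

Import Order.TTheory GRing.Theory Num.Theory.
Import numFieldTopology.Exports numFieldNormedType.Exports.

Local Open Scope classical_set_scope.
Local Open Scope ring_scope.

(** The hyperboloid turns the polytope [P] into a finitely generated cone, and
the Hausdorff bound says that, for [d = (1 - c) r / 2], the boundary of [P] is
farther than [d] from [x0] but meets each ball of radius [r - d] centred on the
sphere.

For a unit tangent direction [v] at [x0], call cap of [v] the half-space beyond
the hyperplane at distance [d] from [x0] that is orthogonal to the ray in the
direction [v].  The ball of radius [r - d] around the point of the sphere in that
direction is contained in the cap, so that every cap contains a boundary point of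
[P] ([cap_meets_boundary]).  Seen from [x0], a cap has angular radius about
[exp (- d)].  It is therefore possible to choose about [exp d] directions, already
on one circle, whose caps are far apart.

Vertices: a half-space that meets [P] contains a vertex of [P], and the caps are
disjoint ([caps_disjoint]); so there are at least as many vertices as caps.

Facets: a boundary point in a cap lies on a facet ([facet_through]).  A facet
reaching two distant caps would contain a geodesic segment joining them, and such
a segment enters the ball of radius [d] around [x0], which contains no boundary
point ([facet_meets_one_cap]); so there are at least as many facets as caps.

To cover all [r > 0] with one exponent, including those for which [exp d] is
close to 1, both numbers are also shown to be at least 2; the constants are then
absorbed into the exponent ([expR_le_count]).

The polyhedral input is proved for cones: a finitely generated cone is a finite
intersection of half-spaces ([cone_halfspaces]), each of its boundary points lies
on a facet ([facet_hyperplane]), and it is generated by exposed rays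
([irredundant_generators], [exposed_generator]). *)

(** * Hyperbolic functions *)

Section hyperbolic_functions.
Context {R : realType}.
Implicit Types s t x : R.

Definition cosh t := (expR t + expR (- t)) / 2.
Definition sinh t := (expR t - expR (- t)) / 2.

Lemma cosh2Bsinh2 t : cosh t ^+ 2 - sinh t ^+ 2 = 1.
Proof.
by rewrite -[RHS](expRxMexpNx_1 t) /cosh /sinh; field.
Qed.

Lemma coshB s t : cosh (s - t) = cosh s * cosh t - sinh s * sinh t.
Proof. by rewrite /cosh /sinh opprB !expRD; field. Qed.

Lemma sinhB s t : sinh (s - t) = sinh s * cosh t - cosh s * sinh t.
Proof. by rewrite /cosh /sinh opprB !expRD; field. Qed.

Lemma cosh_lt s t : 0 <= s -> s < t -> cosh s < cosh t.
Proof.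
move=> s0 st; rewrite /cosh ltr_pM2r// !expRN.
have : expR s < expR t by rewrite ltr_expR.
have : 1 <= expR s by rewrite -expR0 ler_expR.
move: (expR s) (expR t) => a b a1 ab; rewrite -subr_gt0.
have -> : b + b^-1 - (a + a^-1) = (b - a) * (a * b - 1) / (a * b).
  by field; rewrite !gt_eqF//; lra.
by rewrite divr_gt0 ?mulr_gt0//; nra.
Qed.

Lemma cosh0 : cosh 0 = 1. Proof. by rewrite /cosh oppr0 expR0; field. Qed.
Lemma sinh0 : sinh 0 = 0. Proof. by rewrite /sinh oppr0 subrr mul0r. Qed.

Lemma cosh_gt1 t : 0 < t -> 1 < cosh t.
Proof. by move=> t0; rewrite -cosh0 cosh_lt. Qed.

Lemma sinh_gt0 t : 0 < t -> 0 < sinh t.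
Proof. by move=> t0; rewrite divr_gt0// subr_gt0 ltr_expR; lra. Qed.

Lemma cosh_ltE s t : 0 <= s -> 0 <= t -> (cosh s < cosh t) = (s < t).
Proof.
move=> s0 t0; case: (ltgtP s t) => [st|st|->]; last by rewrite ltxx.
- by rewrite cosh_lt.
- by apply/negbTE; rewrite -leNgt ltW// cosh_lt.
Qed.

Lemma arcosh_ge0 x : 1 <= x -> 0 <= arcosh x.
Proof.
move=> x1; apply: ln_ge0; have := sqrtr_ge0 (x ^+ 2 - 1).
by lra.
Qed.

Lemma arcoshK x : 1 <= x -> cosh (arcosh x) = x.
Proof.
move=> x1; rewrite /cosh expRN /arcosh.
have := sqrtr_ge0 (x ^+ 2 - 1).
have : Num.sqrt (x ^+ 2 - 1) ^+ 2 = x ^+ 2 - 1 by rewrite sqr_sqrtr//; nra.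
move: (Num.sqrt _) => q q2 q0.
have xq : 0 < x + q by lra.
rewrite lnK ?posrE//.
have -> : (x + q)^-1 = x - q.
  apply: (mulfI (lt0r_neq0 xq)); rewrite mulfV ?gt_eqF//.
  have -> : (x + q) * (x - q) = x ^+ 2 - q ^+ 2 by ring.
  by rewrite q2; ring.
by field.
Qed.

End hyperbolic_functions.

(** * The future cone and the hyperbolic topology *)

Section lorentz_geometry.
Context {R : realType} {n : nat}.
Implicit Types (u w x y z : 'rV[R]_n.+1) (a b p q : hyp R n).

Lemma lorentzNl x y : lorentz (- x) y = - lorentz x y.
Proof. by rewrite -scaleN1r lorentzZl mulN1r. Qed.

Lemma lorentzNr x y : lorentz x (- y) = - lorentz x y.
Proof. by rewrite lorentzC lorentzNl lorentzC. Qed.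

Definition lorentz_rules := (@lorentzDl R n, @lorentzDr R n, @lorentzZl R n,
  @lorentzZr R n, lorentzNl, lorentzNr).

Lemma lorentz0l x : lorentz 0 x = 0.
Proof. by rewrite -(scale0r 0) lorentzZl mul0r. Qed.

Lemma lorentz0r x : lorentz x 0 = 0.
Proof. by rewrite lorentzC lorentz0l. Qed.

Lemma lorentz_suml I (r : seq I) (F : I -> 'rV[R]_n.+1) x :
  lorentz (\sum_(i <- r) F i) x = \sum_(i <- r) lorentz (F i) x.
Proof.
apply: (big_morph (fun y => lorentz y x)) => [y z|]; last exact: lorentz0l.
exact: lorentzDl.
Qed.

Lemma lorentz_space x : x 0 0 = 0 -> x != 0 -> 0 < lorentz x x.
Proof.
move=> x0 xN0; rewrite /lorentz x0 mulr0 subr0 lt_def.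
rewrite sumr_ge0 ?andbT => [|i _]; last by rewrite -expr2 sqr_ge0.
apply: contra_neq xN0 => /eqP.
rewrite psumr_eq0 => [/allP s0|i _]; last by rewrite -expr2 sqr_ge0.
apply/rowP => j; rewrite mxE; case: (unliftP ord0 j) => [i ->|->//].
by have := s0 i (mem_index_enum _); rewrite mulf_eq0 orbb => /eqP.
Qed.

Lemma lorentz_space_ge0 x : x 0 0 = 0 -> 0 <= lorentz x x.
Proof.
move=> x0; have [->|/(lorentz_space x0)/ltW//] := eqVneq x 0.
by rewrite lorentz0l.
Qed.

Definition future : set 'rV[R]_n.+1 :=
  [set x : 'rV[R]_n.+1 | 0 <= x 0 0 /\ lorentz x x <= 0].

Lemma hyp_gt0 a : 0 < a 0 0.
Proof. by have /andP[] := hvalP a. Qed.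

Lemma future_hyp a : future a.
Proof. by split; [exact/ltW/hyp_gt0|rewrite lorentzxx; lra]. Qed.

Lemma future_eq0 x : future x -> x 0 0 = 0 -> x = 0.
Proof.
move=> [_ xx] x0; apply/eqP; apply: contraTT isT => /(lorentz_space x0).
by rewrite ltNge xx.
Qed.

Lemma future_gt0 x : future x -> x != 0 -> 0 < x 0 0.
Proof.
move=> fx; rewrite lt_def fx.1 andbT; apply: contra_neq.
exact: future_eq0.
Qed.

Let mix x y : lorentz (y 0 0 *: x - x 0 0 *: y) (y 0 0 *: x - x 0 0 *: y) =
  y 0 0 ^+ 2 * lorentz x x + x 0 0 ^+ 2 * lorentz y y
  - x 0 0 * y 0 0 * lorentz x y *+ 2.
Proof. by rewrite !lorentz_rules (lorentzC y x); ring. Qed.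

Let mix0 x y : (y 0 0 *: x - x 0 0 *: y) 0 0 = 0.
Proof. by rewrite !mxE; ring. Qed.

(** The reverse Cauchy-Schwarz inequality, in the only form needed: the combination
[y_0 x - x_0 y] has no time component, so its Lorentz square is nonnegative, and
expanding that square bounds [lorentz x y]. *)
Lemma lorentz_future x y : future x -> future y -> lorentz x y <= 0.
Proof.
move=> fx fy.
have [/(future_eq0 fx) ->|x0] := eqVneq (x 0 0) 0; first by rewrite lorentz0l.
have [/(future_eq0 fy) ->|y0] := eqVneq (y 0 0) 0; first by rewrite lorentz0r.
have {}x0 : 0 < x 0 0 by rewrite lt_def x0 fx.1.
have {}y0 : 0 < y 0 0 by rewrite lt_def y0 fy.1.
have := lorentz_space_ge0 (mix0 x y); rewrite mix => h.
have xy0 : 0 < x 0 0 * y 0 0 by exact: mulr_gt0.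
rewrite -(pmulr_rle0 _ xy0); have := fx.2; have := fy.2.
by have := sqr_ge0 (x 0 0); have := sqr_ge0 (y 0 0); nra.
Qed.

Lemma lorentz_future_lt0 a x : future x -> x != 0 -> lorentz x a < 0.
Proof.
move=> fx xN0; have x0 := future_gt0 fx xN0; have a0 := hyp_gt0 a.
have := lorentz_space_ge0 (mix0 x a); rewrite mix lorentzxx => h.
have xy0 : 0 < x 0 0 * a 0 0 by exact: mulr_gt0.
rewrite -(pmulr_rlt0 _ xy0); have := fx.2.
have : 0 < x 0 0 ^+ 2 by rewrite exprn_gt0.
by have := sqr_ge0 (a 0 0); nra.
Qed.

(** A timelike vector on the same side as a point of hyperbolic space is a future
vector: were its time coordinate negative, its opposite would be in the future
cone, which pairs nonpositively with [a]. *)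
Lemma timelike_future a x : lorentz x x < 0 -> lorentz x a < 0 -> 0 < x 0 0.
Proof.
move=> xx xa; case: (ltgtP (x 0 0) 0) => // x0.
  have fx : future (- x).
    by split; rewrite ?mxE ?oppr_ge0 ?ltW// lorentzNl lorentzC lorentzNl opprK.
  by have := lorentz_future fx (future_hyp a); rewrite lorentzNl; lra.
by have := lorentz_space_ge0 x0; lra.
Qed.

Lemma futureD x y : future x -> future y -> future (x + y).
Proof.
move=> fx fy; split; first by rewrite !mxE addr_ge0 ?fx.1 ?fy.1.
rewrite !lorentz_rules (lorentzC y x).
by have := lorentz_future fx fy; have := fx.2; have := fy.2; lra.
Qed.

Lemma futureZ t x : 0 <= t -> future x -> future (t *: x).
Proof.
move=> t0 fx; split; first by rewrite !mxE mulr_ge0 ?fx.1.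
by rewrite !lorentz_rules mulrA mulr_ge0_le0 ?mulr_ge0 ?fx.2.
Qed.

Lemma hyp_bar_future x : hyp_bar x -> future x /\ x != 0.
Proof.
case=> [|[xx x0]].
  move=> /andP[/eqP xx x0]; split; first by split; [exact: ltW|rewrite xx; lra].
  by apply/eqP => x00; move: x0; rewrite x00 mxE ltxx.
split; first by split; [rewrite x0|rewrite xx].
by apply/eqP => x00; move: x0 => /eqP; rewrite x00 mxE eq_sym oner_eq0.
Qed.

Lemma timelike_hyp x : lorentz x x < 0 -> 0 < x 0 0 ->
  exists2 t, 0 < t & exists a, x = t *: hval a.
Proof.
move=> xx x0; pose t := Num.sqrt (- lorentz x x).
have t0 : 0 < t by rewrite sqrtr_gt0; lra.
have t2 : t ^+ 2 = - lorentz x x by rewrite sqr_sqrtr//; lra.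
have H : hyperboloid (t^-1 *: x).
  apply/andP; split; last by rewrite mxE mulr_gt0 ?invr_gt0.
  have xE : lorentz x x = - t ^+ 2 by lra.
  rewrite !lorentz_rules xE; apply/eqP; field.
  by rewrite gt_eqF.
by exists t => //; exists (Hyp H); rewrite /= scalerA divff ?scale1r ?gt_eqF.
Qed.

Lemma future_hyp_bar x : future x -> x != 0 ->
  exists2 t, 0 < t & exists2 y, hyp_bar y & x = t *: y.
Proof.
move=> fx xN0; have x0 := future_gt0 fx xN0.
have := fx.2; rewrite le_eqVlt => /orP[/eqP xx|xx].
  exists (x 0 0) => //; exists ((x 0 0)^-1 *: x); last first.
    by rewrite scalerA divff ?scale1r ?gt_eqF.
  by right; split; rewrite ?lorentz_rules ?xx ?mulr0// mxE mulVf ?gt_eqF.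
have [t t0 [a xE]] := timelike_hyp xx x0.
by exists t => //; exists a => //; left; exact: hvalP.
Qed.

Lemma hyp_bar_inj t x y : 0 < t -> hyp_bar x -> hyp_bar y -> x = t *: y -> x = y.
Proof.
move=> t0 hx hy xE.
suff t1 : t = 1 by rewrite xE t1 scale1r.
have xx : lorentz x x = t ^+ 2 * lorentz y y by rewrite xE !lorentz_rules; ring.
case: hx => [/andP[/eqP x1 _]|[x1 x0]]; case: hy => [/andP[/eqP y1 _]|[y1 y0]].
- have /eqP : t ^+ 2 = 1 by move: xx; rewrite x1 y1; lra.
  by rewrite sqrf_eq1 => /orP[/eqP//|/eqP]; lra.
- by move: xx; rewrite x1 y1; lra.
- by move: xx; rewrite x1 y1 => /eqP; rewrite mulrN1 eq_sym oppr_eq0 sqrf_eq0 => /eqP; lra.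
- by move: x0; rewrite xE mxE y0 mulr1.
Qed.

(** Subtracting from [u] the multiple of [x] that cancels its time coordinate leaves
a spatial vector, and does not increase the Lorentz square.  For [x] on the light
cone the multiples of [x] itself are orthogonal to [x], hence the exception. *)
Lemma orth_spacelike x u : future x -> x != 0 -> lorentz u x = 0 ->
  (forall t, u != t *: x) -> 0 < lorentz u u.
Proof.
move=> fx xN0 ux unx; have x0 := future_gt0 fx xN0.
pose s := u 0 0 / x 0 0.
have w0 : (u - s *: x) 0 0 = 0 by rewrite !mxE /s divfK ?subrr ?gt_eqF.
have : u - s *: x != 0 by rewrite subr_eq0.
move=> /(lorentz_space w0); rewrite !lorentz_rules (lorentzC x u) ux.
by have := fx.2; have := sqr_ge0 s; nra.
Qed.

Lemma orth_hyp_spacelike a u : u != 0 -> lorentz u a = 0 -> 0 < lorentz u u.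
Proof.
move=> uN0 ua; have [fa aN0] := hyp_bar_future (or_introl (hvalP a)).
apply: (@orth_spacelike a) => // t; apply/eqP => uE.
move: uN0 ua; rewrite uE lorentzZl lorentzxx scaler_eq0 (negbTE aN0) orbF.
by move=> t0 /eqP; rewrite mulrN1 oppr_eq0 (negbTE t0).
Qed.

Lemma cosh_hdist a b : cosh (mdist a b) = - lorentz a b.
Proof. by rewrite arcoshK//; exact: lorentz_hyp_ge1. Qed.

Lemma hdist_lt a b t : 0 <= t -> (mdist a b < t) = (- lorentz a b < cosh t).
Proof.
by move=> t0; rewrite -cosh_hdist cosh_ltE//; apply/arcosh_ge0/lorentz_hyp_ge1.
Qed.

(** Neighbourhoods in the hyperbolic metric, without distances: interiors and
closures become questions about Lorentz products. *)
Lemma nbhs_hypP p (A : set (hyp R n)) :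
  nbhs p A <-> exists2 e, 0 < e & forall q, - lorentz p q < 1 + e -> A q.
Proof.
split=> [/nbhs_ballP[d /= d0 dA]|[e e0 eA]].
  exists (cosh d - 1); first by have := cosh_gt1 d0; lra.
  move=> q pq; apply: dA; rewrite ballEmdist /= hdist_lt ?ltW//.
  by move: pq; rewrite addrC subrK.
have e1 : 1 <= 1 + e by lra.
have d0 : 0 < arcosh (1 + e).
  by rewrite lt_def arcosh_ge0// andbT; apply/eqP => h;
    have := arcoshK e1; rewrite h cosh0; lra.
apply/nbhs_ballP; exists (arcosh (1 + e)) => //= q.
by rewrite ballEmdist /= hdist_lt ?ltW// arcoshK//; exact: eA.
Qed.

(** Half-spaces are open.  Writing [q = k p + w] with [w] orthogonal to [p], the
variation of [lorentz u] is controlled by Cauchy-Schwarz in the positive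
semidefinite space orthogonal to [p], where [w] has square [k^2 - 1]. *)
Lemma near_lorentz_lt0 p u : lorentz u p < 0 ->
  \forall q \near p, lorentz u (hval q) < 0.
Proof.
move=> up; pose u' := u + lorentz u p *: hval p.
have u'p : lorentz u' p = 0 by rewrite !lorentz_rules lorentzxx; ring.
have B0 := lorentz_orth_ge0 u'p; set B := lorentz u' u' in B0.
pose e := lorentz u p ^+ 2 / (3 * (B + lorentz u p ^+ 2)).
have up2 : 0 < lorentz u p ^+ 2 by rewrite exprn_even_gt0//= lt_eqF.
have D0 : 0 < 3 * (B + lorentz u p ^+ 2) by lra.
have e0 : 0 < e by rewrite divr_gt0.
have e1 : e <= 1 by rewrite ler_pdivrMr//; lra.
have eB : B * (3 * e) < lorentz u p ^+ 2.
  rewrite /e; have -> : B * (3 * (lorentz u p ^+ 2 / (3 * (B + lorentz u p ^+ 2)))) =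
    B * lorentz u p ^+ 2 / (B + lorentz u p ^+ 2).
    by field; rewrite gt_eqF//; lra.
  by rewrite ltr_pdivrMr; nra.
apply/nbhs_hypP; exists e => // q pq.
have k1 := lorentz_hyp_ge1 p q; set k := - lorentz p q in pq k1.
pose w := hval q - k *: hval p.
have wp : lorentz w p = 0.
  rewrite /w -scaleNr opprK lorentzDl lorentzZl lorentzxx lorentzC; ring.
have ww : lorentz w w = k ^+ 2 - 1.
  rewrite /w !lorentz_rules !lorentzxx (lorentzC q p) /k; ring.
have CS := lorentz_orth_CS u'p wp; rewrite ww -/B in CS.
have uq : lorentz u q = k * lorentz u p + lorentz u' w.
  rewrite /w /u' !lorentz_rules lorentzxx /k; ring.
have h : lorentz u' w ^+ 2 < lorentz u p ^+ 2.
  apply: le_lt_trans CS _; apply: le_lt_trans eB; apply: ler_wpM2l => //.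
  by nra.
rewrite uq; move: h; rewrite -ltr_sqrt// !sqrtr_sqr (ltr0_norm up) => h.
by have := le_lt_trans (ler_norm _) h; nra.
Qed.

(** A hyperplane through [p] has points of each neighbourhood of [p] strictly on its
positive side, found by leaving [p] along the normal [u]. *)
Lemma nbhs_separated p (A : set (hyp R n)) u : nbhs p A -> u != 0 ->
  lorentz u p = 0 -> exists2 q, A q & 0 < lorentz u q.
Proof.
move=> /nbhs_hypP[e e0 eA] uN0 up; have uu := orth_hyp_spacelike uN0 up.
set s := lorentz u u in uu.
(* k p + t u lies on the hyperboloid as soon as t^2 <u, u> = k^2 - 1, and then
   pairs with p to - k; k = 1 + e / 2 puts it in the neighbourhood. *)
pose k := 1 + e / 2.
pose t := Num.sqrt ((k ^+ 2 - 1) / s).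
have k2 : 0 < k ^+ 2 - 1 by rewrite /k; nra.
have t0 : 0 < t by rewrite sqrtr_gt0 divr_gt0.
have t2 : t ^+ 2 * s = k ^+ 2 - 1.
  by rewrite sqr_sqrtr ?ltW ?divr_gt0// divfK// gt_eqF.
pose x := k *: hval p + t *: u.
have xx : lorentz x x = -1.
  rewrite !lorentz_rules lorentzxx (lorentzC p u) up -/s; lra.
have xp : lorentz x p = - k by rewrite !lorentz_rules lorentzxx up; ring.
have H : hyperboloid x.
  rewrite /hyperboloid xx eqxx; apply: (@timelike_future p).
    by rewrite xx; lra.
  by rewrite xp /k; lra.
exists (Hyp H); first by apply: eA; rewrite lorentzC /= xp opprK /k; lra.
by rewrite /= !lorentz_rules up mulr0 add0r mulr_gt0.
Qed.

End lorentz_geometry.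

(** * Finitely generated cones *)

Section cones.
Context {R : realFieldType} {E : lmodType R}.
Implicit Types (s : seq E) (x y v : E) (C : set E).

(** The nonnegative combinations of a sequence.  Peeling off one coefficient at a
time makes Fourier-Motzkin elimination an induction on the generators. *)
Fixpoint cone s : set E :=
  if s is v :: s' then [set x | exists2 t, 0 <= t & cone s' (x - t *: v)]
  else [set 0].

Definition convex_cone C := [/\ C 0, forall x y, C x -> C y -> C (x + y) &
  forall t x, 0 <= t -> C x -> C (t *: x)].

Lemma cone_convex s : convex_cone (cone s).
Proof.
elim: s => [|v s [c0 cD cZ]]; split => //=.
- by move=> x y -> ->; rewrite addr0.
- by move=> t x _ ->; rewrite scaler0.
- by exists 0 => //; rewrite scale0r subr0.
- move=> x y [a a0 ax] [b b0 bx]; exists (a + b); rewrite ?addr_ge0//.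
  by rewrite scalerDl opprD addrACA; exact: cD.
- move=> t x t0 [a a0 ax]; exists (t * a); rewrite ?mulr_ge0//.
  by rewrite -scalerA -scalerBr; exact: cZ.
Qed.

Lemma cone0 s : cone s 0. Proof. by have [] := cone_convex s. Qed.

Lemma coneD s x y : cone s x -> cone s y -> cone s (x + y).
Proof. by have [_ + _] := cone_convex s; apply. Qed.

Lemma coneZ s t x : 0 <= t -> cone s x -> cone s (t *: x).
Proof. by have [_ _] := cone_convex s; apply. Qed.

Lemma cone_min s C : convex_cone C -> {in s, forall v, C v} -> cone s `<=` C.
Proof.
move=> [C0 CD CZ]; elim: s => [|v s IH] sC x /=; first by move=> ->.
move=> [t t0 h]; rewrite -(subrK (t *: v) x); apply: CD.
  by apply: IH h => w ws; apply: sC; rewrite inE ws orbT.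
by apply: CZ => //; apply: sC; rewrite inE eqxx.
Qed.

Lemma cone_mem s v : v \in s -> cone s v.
Proof.
elim: s => // w s IH; rewrite inE => /orP[/eqP ->|/IH vs] /=.
  by exists 1; rewrite ?scale1r ?subrr//; exact: cone0.
by exists 0 => //; rewrite scale0r subr0.
Qed.

Lemma cone_sub s s' : {subset s <= s'} -> cone s `<=` cone s'.
Proof.
by move=> ss'; apply: cone_min (cone_convex s') _ => v /ss'; exact: cone_mem.
Qed.

(** Permuting the generators leaves the cone unchanged, so any of them can be split
off first. *)
Lemma cone_rem s v x : v \in s -> cone s x ->
  exists2 t, 0 <= t & cone (rem v s) (x - t *: v).
Proof.
move=> vs; apply: (@cone_sub s (v :: rem v s)) => w.
by rewrite (perm_mem (perm_to_rem vs)).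
Qed.

Lemma irredundant_generators s : exists s', [/\ {subset s' <= s},
  cone s' = cone s & forall v, v \in s' -> ~ cone (rem v s') v].
Proof.
have [k] := ubnP (size s); elim: k s => // k IH s sk.
have [[v vs vrem]|nov] := pselect (exists2 v, v \in s & cone (rem v s) v); last first.
  by exists s; split => // v vs vrem; apply: nov; exists v.
have remE : cone (rem v s) = cone s.
  apply/seteqP; split; first by apply: cone_sub => w /mem_rem.
  apply: cone_min (cone_convex _) _ => w.
  by rewrite (perm_mem (perm_to_rem vs)) inE => /orP[/eqP ->//|/cone_mem].
have [|s' [s'r s'E s'P]] := IH (rem v s).
  by rewrite size_rem//; case: (s) vs sk.
rewrite -remE; exists s'; split => // w /s'r; exact: mem_rem.
Qed.

Lemma seq_argmax (T : eqType) (t : seq T) (f : T -> R) w0 : w0 \in t ->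
  exists2 m, m \in t & {in t, forall w, f w <= f m}.
Proof.
elim: t w0 => // v t IH w0 _.
case: t IH => [_|w t /(_ w (mem_head _ _))[m mt mM]].
  by exists v; rewrite ?mem_head// => w; rewrite inE => /eqP ->.
have [vm|mv] := leP (f v) (f m).
  exists m; first by rewrite inE mt orbT.
  by move=> z; rewrite inE => /orP[/eqP ->//|/mM].
exists v; first exact: mem_head.
move=> z; rewrite inE => /orP[/eqP ->//|/mM zm].
exact: le_trans zm (ltW mv).
Qed.

End cones.

(** * Half-spaces, facets and exposed rays of cones *)

Section polyhedral_cones.
Context {R : realType} {n : nat}.
Implicit Types (u v w x y : 'rV[R]_n.+1) (s us : seq 'rV[R]_n.+1).

Lemma halfspace_convex u : convex_cone [set x | lorentz u x <= 0].
Proof.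
split => /=; first by rewrite lorentz0r.
  by move=> x y ux uy; rewrite lorentz_rules; lra.
by move=> t x t0 ux; rewrite lorentz_rules; nra.
Qed.

Lemma cone_le0 s u x : {in s, forall w, lorentz u w <= 0} -> cone s x -> lorentz u x <= 0.
Proof. by move=> us sx; exact: (cone_min (halfspace_convex u) us sx). Qed.

Lemma cone_gt0 s u x : cone s x -> 0 < lorentz u x ->
  exists2 w, w \in s & 0 < lorentz u w.
Proof.
move=> sx ux; apply: contrapT => h; move: ux; apply/negP; rewrite -leNgt.
apply: cone_le0 sx => w ws; rewrite leNgt; apply/negP => uw.
by apply: h; exists w.
Qed.

(** In a combination of generators on one side of a hyperplane that lies in the
hyperplane, only generators in the hyperplane have a nonzero coefficient. *)
Lemma cone_face s u x : {in s, forall w, lorentz u w <= 0} -> cone s x ->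
  lorentz u x = 0 -> cone [seq w <- s | lorentz u w == 0] x.
Proof.
elim: s x => [|v s IH] x us //= [t t0 h] ux.
have uv : lorentz u v <= 0 by apply: us; exact: mem_head.
have {}us w : w \in s -> lorentz u w <= 0 by move=> ws; apply: us; rewrite inE ws orbT.
have := cone_le0 us h; rewrite !lorentz_rules ux => hle.
have tuv : t * lorentz u v = 0 by nra.
have {}h : cone [seq w <- s | lorentz u w == 0] (x - t *: v).
  by apply: IH => //; rewrite !lorentz_rules ux; lra.
case: ifP => uv0; first by exists t.
move/eqP: tuv; rewrite mulf_eq0 uv0 orbF => /eqP tE.
by move: h; rewrite tE scale0r subr0.
Qed.

(** Changing the sign of the time coordinate turns the Lorentz form into the matrix
product, so that rank and kernel computations apply to Lorentz orthogonality. *)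
Definition flip u : 'rV[R]_n.+1 := \row_j (if j == 0 then - u 0 0 else u 0 j).

Lemma flipK : involutive flip.
Proof. by move=> u; apply/rowP => j; rewrite !mxE; case: eqP => // ->; rewrite opprK. Qed.

Lemma lorentz_flip u x : lorentz (flip u) x = (x *m u^T) 0 0.
Proof.
rewrite /lorentz !mxE big_ord_recl !mxE /= mulNr opprK addrC mulrC; congr (_ + _).
by apply: eq_bigr => i _; rewrite !mxE mulrC.
Qed.

Lemma lorentz_nondegenerate u : (forall x, lorentz u x = 0) -> u = 0.
Proof.
move=> h; have fu0 : flip u = 0.
  apply/rowP => k; have := h (delta_mx 0 k).
  by rewrite -[u in lorentz u]flipK lorentz_flip -rowE 2!mxE => ->; rewrite mxE.
by rewrite -[u]flipK fu0; apply/rowP => j; rewrite !mxE oppr0 if_same.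
Qed.

Definition rows s : 'M[R]_(size s, n.+1) := \matrix_(i < size s) s`_i.

Lemma mem_rows s w : w \in s -> (w <= rows s)%MS.
Proof.
move=> ws; have i : (index w s < size s)%N by rewrite index_mem.
have -> : w = row (Ordinal i) (rows s) by rewrite rowK /= nth_index.
exact: row_sub.
Qed.

Lemma row_rows s i : row i (rows s) \in s.
Proof. by rewrite rowK mem_nth. Qed.

Lemma rows_sub s m (A : 'M[R]_(m, n.+1)) : {in s, forall w, (w <= A)%MS} -> (rows s <= A)%MS.
Proof. by move=> h; apply/row_subP => i; apply/h/row_rows. Qed.

Lemma lorentz_rows u s x : {in s, forall w, lorentz u w = 0} ->
  (x <= rows s)%MS -> lorentz u x = 0.
Proof.
move=> us /submxP[D ->]; rewrite -[u]flipK lorentz_flip -mulmxA.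
suff -> : rows s *m (flip u)^T = 0 by rewrite mulmx0 mxE.
apply/row_matrixP => i; rewrite row_mul row0; apply/rowP => j.
by rewrite ord1 -lorentz_flip flipK us ?mxE// row_rows.
Qed.

Lemma cone_rows s x : cone s x -> (x <= rows s)%MS.
Proof.
have sP : {in s, forall w, [set x : 'rV[R]_n.+1 | (x <= rows s)%MS] w} by exact: mem_rows.
apply: (cone_min _ sP).
split => /=; [exact: sub0mx|by move=> *; exact: addmx_sub|].
by move=> *; exact: scalemx_sub.
Qed.

Lemma exists_orthogonal s : (\rank (rows s) <= n)%N ->
  exists2 u, u != 0 & {in s, forall w, lorentz u w = 0}.
Proof.
move=> rk; have : kermx (rows s)^T != 0.
  by rewrite kermx_eq0 /row_free mxrank_tr; apply/eqP => h; rewrite h ltnn in rk.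
move=> /rowV0Pn[c /sub_kermxP c0 cN0]; exists (flip c).
  by apply: contra_neq cN0 => /(congr1 flip); rewrite flipK => ->;
    apply/rowP => j; rewrite !mxE oppr0 if_same.
move=> w /mem_rows/submxP[D ->]; rewrite lorentz_flip -mulmxA.
by rewrite -[rows s]trmxK -trmx_mul c0 trmx0 mulmx0 mxE.
Qed.

Lemma rank_orthogonal s u : u != 0 -> {in s, forall w, lorentz u w = 0} ->
  (\rank (rows s) <= n)%N.
Proof.
move=> uN0 us; rewrite -ltnS ltn_neqAle rank_leq_col andbT.
apply: contra_neqN uN0 => /eqP full; apply: lorentz_nondegenerate => x.
by apply: lorentz_rows us _; apply: submx_full; rewrite /row_full full.
Qed.

Lemma spanning_nonorthogonal s u : \rank (rows s) = n.+1 -> u != 0 ->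
  exists2 w, w \in s & lorentz u w != 0.
Proof.
move=> rk uN0; apply: contrapT => h.
suff : (\rank (rows s) <= n)%N by rewrite rk ltnn.
apply: (rank_orthogonal uN0) => w ws; apply/eqP.
by apply: contrapT => /negP uw; apply: h; exists w.
Qed.

(** Weyl's theorem.  Adding a generator [v] to a cone cut out by [us] amounts to
eliminating [t] from the system [lorentz u (x - t v) <= 0], [0 <= t]: constraints
with [lorentz u v <= 0] survive as they are, and each lower bound for [t] is
combined with each upper bound. *)
Lemma cone_halfspaces s : exists us, forall x,
  cone s x <-> {in us, forall u, lorentz u x <= 0}.
Proof.
elim: s => [|v s [us usP]].
  pose ds := [seq delta_mx 0 i | i <- enum 'I_n.+1] : seq 'rV[R]_n.+1.
  exists (ds ++ map -%R ds) => x /=; split.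
    by move=> -> u _; rewrite lorentz0r.
  move=> h; apply: lorentz_nondegenerate => y; rewrite lorentzC.
  rewrite [y]matrix_sum_delta big_ord1 lorentz_suml.
  apply: big1 => j _; rewrite lorentzZl.
  have jd : delta_mx 0 j \in ds by apply: map_f; rewrite mem_enum.
  have := h (delta_mx 0 j); rewrite mem_cat jd => /(_ isT) h1.
  have := h (- delta_mx 0 j); rewrite mem_cat map_f ?orbT// => /(_ isT).
  rewrite lorentzNl => h2.
  have -> : lorentz (delta_mx 0 j) x = 0 by lra.
  by rewrite mulr0.
pose pos := [seq u <- us | 0 < lorentz u v].
pose nonpos := [seq u <- us | lorentz u v <= 0].
pose eliminate u w := lorentz u v *: w - lorentz w v *: u.
exists (nonpos ++ [seq eliminate u w | u <- pos, w <- nonpos]) => x /=; split.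
  move=> [t t0 /usP h] z; rewrite mem_cat => /orP[|/allpairsP[[u w] /= [+ + ->]]].
    rewrite mem_filter => /andP[zv zus]; have := h _ zus.
    by rewrite !lorentz_rules; nra.
  rewrite !mem_filter => /andP[uv uus] /andP[wv wus].
  have := h _ uus; have := h _ wus; rewrite /eliminate !lorentz_rules.
  by nra.
move=> h.
have [t tL tM] := seq_argmax id
  (mem_head 0 [seq lorentz u x / lorentz u v | u <- pos]).
have t0 : 0 <= t by apply: tM; exact: mem_head.
exists t => //; apply/usP => w wus.
rewrite !lorentz_rules subr_le0.
have [wv|wv] := ltP 0 (lorentz w v).
  rewrite -ler_pdivrMr//; apply: tM; rewrite inE; apply/orP; right.
  by apply: map_f; rewrite mem_filter wv.
have wnp : w \in nonpos by rewrite mem_filter wv.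
move: tL; rewrite inE => /orP[/eqP ->|/mapP[u up ->]].
  by rewrite mul0r; apply: h; rewrite mem_cat wnp.
have uv : 0 < lorentz u v by move: up; rewrite mem_filter => /andP[].
have := h (eliminate u w); rewrite mem_cat allpairs_f ?orbT// => /(_ isT).
rewrite /eliminate !lorentz_rules => le0.
rewrite mulrAC ler_pdivlMr//; lra.
Qed.

(** A supporting hyperplane can be rotated, keeping the generators that it contains,
until these span it.  If they span less, some nonzero form [u'] vanishes on them
and on a generator [z] off the hyperplane; [u + t u'] stays nonpositive on the
generators up to the first [t] at which a new generator is reached, which
increases the rank.  The point [x] stays in the hyperplane because it is a
combination of the generators kept. *)
Lemma facet_hyperplane s u x : \rank (rows s) = n.+1 -> cone s x ->
  u != 0 -> {in s, forall w, lorentz u w <= 0} -> lorentz u x = 0 ->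
  exists u', [/\ u' != 0, {in s, forall w, lorentz u' w <= 0}, lorentz u' x = 0 &
    \rank (rows [seq w <- s | lorentz u' w == 0]) = n].
Proof.
move=> rk sx.
have [k] := ubnP (n - \rank (rows [seq w <- s | lorentz u w == 0])).
elim: k u => // k IH u + uN0 us ux.
set W := [seq w <- s | lorentz u w == 0] => kP.
have WP w : w \in W -> lorentz u w = 0 by rewrite mem_filter => /andP[/eqP].
have rkW := rank_orthogonal uN0 WP.
have [Wn|Wn] := eqVneq (\rank (rows W)) n; first by exists u.
have {}rkW : (\rank (rows W) < n)%N by rewrite ltn_neqAle Wn.
have [z zs uz] := spanning_nonorthogonal rk uN0.
have [|u' u'N0 u'W] := @exists_orthogonal (z :: W).
  have zW : (rows (z :: W) <= z + rows W)%MS.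
    apply: rows_sub => w; rewrite inE => /orP[/eqP ->|/mem_rows ww]; first exact: addsmxSl.
    by apply: submx_trans ww _; exact: addsmxSr.
  apply: leq_trans (mxrankS zW) _; apply: leq_trans (mxrank_adds_leqif _ _) _.
  by apply: leq_trans rkW; rewrite -[X in (_ <= X)%N]add1n leq_add2r rank_leq_row.
have u'z : lorentz u' z = 0 by apply: u'W; exact: mem_head.
have {}u'W w : w \in W -> lorentz u' w = 0 by move=> ww; apply: u'W; rewrite inE ww orbT.
wlog [v vs u'v] : u' u'N0 u'z u'W / exists2 v, v \in s & 0 < lorentz u' v.
  move=> hwlog; have [v vs] := spanning_nonorthogonal rk u'N0.
  case: (ltgtP (lorentz u' v) 0) => // u'v _; last by apply: (hwlog u') => //; exists v.
  apply: (hwlog (- u')); rewrite ?oppr_eq0 ?lorentzNl ?u'z ?oppr0//.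
    by move=> w /u'W; rewrite lorentzNl => ->; rewrite oppr0.
  by exists v => //; rewrite lorentzNl oppr_gt0.
pose pos := [seq w <- s | 0 < lorentz u' w].
have vpos : v \in pos by rewrite mem_filter u'v.
have [w0] := seq_argmax (fun w => lorentz u w / lorentz u' w) vpos.
rewrite mem_filter => /andP[u'w0 w0s] w0M.
(* the ratio test: the least t at which u + t u' vanishes on a generator w with
   0 < lorentz u' w is reached at w0 *)
pose t := - (lorentz u w0 / lorentz u' w0).
have t0 : 0 <= t.
  by rewrite oppr_ge0 pmulr_lle0 ?invr_gt0//; exact: us.
pose u2 := u + t *: u'.
have u2E w : lorentz u2 w = lorentz u w + t * lorentz u' w by rewrite !lorentz_rules.
have u2s : {in s, forall w, lorentz u2 w <= 0}.
  move=> w ws; have uw := us _ ws; rewrite u2E.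
  have [u'w|u'w] := ltP 0 (lorentz u' w); last by nra.
  have : lorentz u w / lorentz u' w <= - t.
    by rewrite opprK; apply: w0M; rewrite mem_filter u'w.
  by rewrite ler_pdivrMr//; lra.
have u2W : {subset W <= [seq w <- s | lorentz u2 w == 0]}.
  move=> w wW; have := wW; rewrite !mem_filter => /andP[/eqP uw ->].
  by rewrite u2E uw u'W// mulr0 addr0 eqxx.
have w0u2 : w0 \in [seq w <- s | lorentz u2 w == 0].
  rewrite mem_filter w0s andbT u2E /t mulNr divfK ?subrr//.
  by rewrite gt_eqF.
apply: (IH u2) => //.
- rewrite ltnS in kP; apply: leq_trans kP; apply: ltn_sub2l rkW _; apply: rank_ltmx.
  rewrite ltmxE rows_sub => [|w /u2W/mem_rows//]; apply/negP => h.
  have := lorentz_rows u'W (submx_trans (mem_rows w0u2) h) => u'w00.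
  by move: u'w0; rewrite u'w00 ltxx.
- apply: contra_neq uz => u20; have := u2E z.
  by rewrite u20 lorentz0l u'z mulr0 addr0 => <-.
- rewrite u2E ux (lorentz_rows u'W) ?mulr0 ?addr0//.
  by apply: cone_rows; apply: cone_face.
Qed.

(** An irredundant generator spans an extremal ray.  Were the coefficients of [v] in
[x] and [y] to sum to less than 1, [v] would be a combination of the other
generators; otherwise the other parts of [x] and [y], which are future vectors, sum to
a nonpositive multiple of [v], hence vanish. *)
Lemma cone_extremal s v x y : {in s, forall w, future w} -> v \in s ->
  ~ cone (rem v s) v -> cone s x -> cone s y -> x + y = v -> exists t, x = t *: v.
Proof.
move=> fs vs vrem /(cone_rem vs)[a a0 xa] /(cone_rem vs)[b b0 yb] xyv.
have remf : cone (rem v s) `<=` future.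
  apply: cone_min => [|w /mem_rem/fs//]; split.
  - by split; rewrite ?mxE ?lorentz0l.
  - exact: futureD.
  - exact: futureZ.
have fv := fs _ vs; have fx := remf _ xa; have fy := remf _ yb.
set x' := x - a *: v in xa fx; set y' := y - b *: v in yb fy.
have E : x' + y' = (1 - a - b) *: v.
  by rewrite /x' /y' addrACA xyv !scalerBl scale1r addrA.
have [ab|ab] := ltP 0 (1 - a - b).
  have : cone (rem v s) ((1 - a - b)^-1 *: (x' + y')).
    by apply: coneZ; [rewrite invr_ge0 ltW|exact: coneD].
  by rewrite E scalerK// gt_eqF.
have E0 : x' 0 0 + y' 0 0 = (1 - a - b) * v 0 0 by move/rowP/(_ 0): E; rewrite !mxE.
have x'0 : x' = 0.
  by apply: future_eq0 => //; have := fx.1; have := fy.1; have := fv.1; nra.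
by exists a; apply/eqP; rewrite -subr_eq0 -/x' x'0.
Qed.

Lemma small_perturbation us v y : {in us, forall u, lorentz u v <= 0} ->
  {in us, forall u, lorentz u v = 0 -> lorentz u y = 0} ->
  exists2 e, 0 < e & forall t, `|t| <= e -> {in us, forall u, lorentz u (v + t *: y) <= 0}.
Proof.
elim: us => [|u us IH] usv usy; first by exists 1.
have [||e e0 eP] := IH.
- by move=> w ws; apply: usv; rewrite inE ws orbT.
- by move=> w ws; apply: usy; rewrite inE ws orbT.
have uv := usv _ (mem_head _ _); have uy := usy _ (mem_head _ _).
suff [e' e'0 e'P] : exists2 e', 0 < e' &
    forall t, `|t| <= e' -> lorentz u (v + t *: y) <= 0.
  exists (Num.min e e'); first by rewrite lt_min e0.
  move=> t; rewrite le_min => /andP[te te'] w; rewrite inE => /orP[/eqP ->|ws].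
    exact: e'P.
  exact: eP.
have [uv0|uvN0] := eqVneq (lorentz u v) 0.
  by exists 1 => // t _; rewrite !lorentz_rules uv0 uy// mulr0 addr0.
have {}uv : lorentz u v < 0 by rewrite lt_def eq_sym uvN0.
exists (- lorentz u v / (1 + `|lorentz u y|)).
  by rewrite divr_gt0 ?oppr_gt0// ltr_wpDr.
move=> t; rewrite ler_pdivlMr ?ltr_wpDr// => tP; rewrite !lorentz_rules.
have := ler_norm (t * lorentz u y); rewrite normrM => h.
by have := normr_ge0 t; nra.
Qed.

(** An irredundant generator is the only one on some spacelike supporting hyperplane.
The constraints active at [v] vanish together only on the line of [v], since
otherwise [v] could be moved both ways inside the cone, against extremality.
Their sum thus exposes [v]; it is spacelike unless [v] is ideal and the sum is a
multiple of [v], in which case one active constraint is counted twice.  The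
bound on [n] provides an active constraint that is not a multiple of [v]: else
every vector orthogonal to [v] would be one. *)
Lemma exposed_generator s v : (2 <= n)%N -> hyp R n -> {in s, forall w, hyp_bar w} ->
  v \in s -> ~ cone (rem v s) v ->
  exists u, [/\ 0 < lorentz u u, forall x, cone s x -> lorentz u x <= 0,
    lorentz u v = 0 & forall x, cone s x -> lorentz u x = 0 -> exists t, x = t *: v].
Proof.
move=> n2 a sbar vs vrem; have [us usP] := cone_halfspaces s.
have [fv vN0] := hyp_bar_future (sbar _ vs).
have fs : {in s, forall w, future w} by move=> w /sbar/hyp_bar_future[].
have usv : {in us, forall u, lorentz u v <= 0} by apply/usP/cone_mem.
have active y : {in us, forall u, lorentz u v = 0 -> lorentz u y = 0} ->
    exists t, y = t *: v.
  move=> usy; have [e e0 eP] := small_perturbation usv usy.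
  have he t : `|t| <= e -> cone s (v + t *: y) by move=> te; apply/usP/eP.
  have half0 : 0 <= 2^-1 :> R by rewrite invr_ge0.
  have [|||t tE] := cone_extremal (x := 2^-1 *: (v + e *: y))
    (y := 2^-1 *: (v + (- e) *: y)) fs vs vrem.
  - by apply: coneZ half0 _; apply: he; rewrite ger0_norm// ltW.
  - by apply: coneZ half0 _; apply: he; rewrite normrN ger0_norm// ltW.
  - by apply/rowP => j; rewrite !mxE; field.
  exists (e^-1 * (2 * t - 1)); apply/rowP => j.
  have := congr1 (fun x : 'rV_n.+1 => x 0 j) tE; rewrite !mxE => tj.
  have -> : y 0 j = e^-1 * (2 * (2^-1 * (v 0 j + e * y 0 j)) - v 0 j).
    by field; rewrite gt_eqF.
  by rewrite tj; ring.
pose act := [seq u <- us | lorentz u v == 0].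
have actP w : w \in act -> w \in us /\ lorentz w v = 0.
  by rewrite mem_filter => /andP[/eqP].
have [w0 w0a w0v] : exists2 w, w \in act & forall t, w != t *: v.
  apply: contrapT => h.
  have [|y yN0 yP] := @exists_orthogonal [:: v; hval a].
    exact: leq_trans (rank_leq_row _) _.
  have yv : lorentz v y = 0 by rewrite lorentzC yP ?mem_head.
  have ya : lorentz y a = 0 by rewrite yP ?inE ?eqxx ?orbT.
  have [|t yE] := active y.
    move=> u uus uv; have [[t ->]|nt] := pselect (exists t, u = t *: v).
      by rewrite lorentzZl yv mulr0.
    case: h; exists u; first by rewrite mem_filter uv eqxx.
    by move=> t; apply/eqP => uE; apply: nt; exists t.
  move: yN0 ya; rewrite yE lorentzZl scaler_eq0 negb_or => /andP[t0 _] /eqP.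
  by rewrite mulf_eq0 (negbTE t0) (lt_eqF (lorentz_future_lt0 a fv vN0)).
have exposing r : {subset act <= r} -> {subset r <= act} ->
    (forall t, \sum_(w <- r) w != t *: v) -> exists u,
    [/\ 0 < lorentz u u, forall x, cone s x -> lorentz u x <= 0,
    lorentz u v = 0 & forall x, cone s x -> lorentz u x = 0 -> exists t, x = t *: v].
  move=> ar ra ut; exists (\sum_(w <- r) w).
  have rle0 x : cone s x -> {in r, forall w, lorentz w x <= 0}.
    by move=> /usP sx w /ra/actP[/sx].
  have rv : lorentz (\sum_(w <- r) w) v = 0.
    by rewrite lorentz_suml big_seq big1// => w /ra/actP[].
  split=> //; first exact: orth_spacelike fv vN0 rv ut.
    move=> x /rle0 rx; rewrite lorentz_suml big_seq; exact: sumr_le0.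
  move=> x sx; rewrite lorentz_suml => /eqP; rewrite -oppr_eq0 -sumrN big_seq_cond.
  rewrite psumr_eq0 => [/allP r0|w]; last first.
    by rewrite andbT oppr_ge0 => wr; exact: rle0.
  apply: active => u uus uv; have ur : u \in r by rewrite ar// mem_filter uv eqxx.
  by have := r0 _ ur; rewrite ur /= oppr_eq0 => /eqP.
have [[t tE]|nt] := pselect (exists t, \sum_(w <- act) w = t *: v); last first.
  by apply: (exposing act) => // t; apply/eqP => tE; apply: nt; exists t.
apply: (exposing (w0 :: act)).
- by move=> w wa; rewrite inE wa orbT.
- by move=> w; rewrite inE => /orP[/eqP ->|].
- move=> t'; rewrite big_cons tE; apply: contra (w0v (t' - t)) => /eqP w0E.
  by rewrite scalerBl -w0E addrK.
Qed.

End polyhedral_cones.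

(** * Polytopes as sections of cones *)

Section generated_polytopes.
Context {R : realType} {n : nat}.
Implicit Types (u v w x y : 'rV[R]_n.+1) (s : seq 'rV[R]_n.+1).
Implicit Types (p q : hyp R n) (P : set (hyp R n)).

(** The linear model: the polytope is the section by the hyperboloid of a finitely
generated cone whose generators may be ideal points. *)
Definition generates s P :=
  {in s, forall w, hyp_bar w} /\ forall q, P q <-> cone s (hval q).

(** Geodesics are traces of planes, so hyperbolic convexity is convexity of the cone
spanned.  For the inclusion that is not formal, a combination is rebuilt one
generator at a time: the sum of the others is a future vector, hence a multiple
of a point of [hyp_bar] that is already in the hull. *)
Lemma hconvex_hull_cone s : {in s, forall w, hyp_bar w} ->
  hconvex_hull [set` s] = hyp_bar `&` cone s.
Proof.
move=> sbar; apply/seteqP; split.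
  apply: smallest_sub => [|w ws]; last by split; [exact: sbar|exact: cone_mem].
  split=> [x []//|x y [_ sx] [_ sy] z [zbar [a [b [a0 b0 zE]]]]].
  by split=> //; rewrite zE; apply: coneD; exact: coneZ.
move=> x [xbar sx] C [[Cbar Cgeo] sC].
have {sC}: {in s, forall w, C w} by move=> w; exact: sC.
have fs : {in s, forall w, future w} by move=> w /sbar/hyp_bar_future[].
elim: s x xbar sx fs {sbar} => [|v s IH] x xbar sx fs sC.
  by have [_] := hyp_bar_future xbar; rewrite sx eqxx.
have [t t0 h] := sx; have Cv : C v by apply: sC; exact: mem_head.
have fs' : {in s, forall w, future w} by move=> w ws; apply: fs; rewrite inE ws orbT.
have fy : future (x - t *: v).
  apply: (cone_min _ fs') h; split; [|exact: futureD|exact: futureZ].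
  by split; rewrite ?mxE ?lorentz0l.
have [yE|yN0] := eqVneq (x - t *: v) 0.
  apply: (Cgeo v v Cv Cv); split => //; exists t, 0; split => //.
  by rewrite scale0r addr0; apply/eqP; rewrite -subr_eq0 yE.
have [k k0 [z zbar zE]] := future_hyp_bar fy yN0.
have Cz : C z.
  apply: IH => //; last by move=> w ws; apply: sC; rewrite inE ws orbT.
  have -> : z = k^-1 *: (x - t *: v) by rewrite zE scalerK// gt_eqF.
  by apply: coneZ => //; rewrite invr_ge0 ltW.
apply: (Cgeo v z Cv Cz); split => //; exists t, k; split => //; first exact: ltW.
by rewrite -zE addrC subrK.
Qed.

Lemma polytope_generators P : convex_polytope P -> exists s, generates s P /\
  forall v, v \in s -> ~ cone (rem v s) v.
Proof.
move=> [_ [V [/finite_seqP[s ->] sbar PE]]].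
have [s' [s's s'E s'P]] := irredundant_generators s.
exists s'; split => //; split; first by move=> w /s's; exact: sbar.
move=> q; rewrite PE /= hconvex_hull_cone; last by move=> w; exact: sbar.
by rewrite s'E; split => [[]//|sq]; split => //; left; exact: hvalP.
Qed.

(** With finitely many closed half-spaces cutting out the cone, a point satisfying
all nontrivial constraints strictly would be interior. *)
Lemma boundary_supported s P q : generates s P -> boundary P q ->
  cone s q /\ exists u, [/\ u != 0, {in s, forall w, lorentz u w <= 0} &
    lorentz u q = 0].
Proof.
move=> [_ PE] [qcl qint]; have [us usP] := cone_halfspaces s.
have sq : cone s q.
  apply/usP => u uus; rewrite leNgt; apply/negP => uq.
  have : lorentz (- u) q < 0 by rewrite lorentzNl oppr_lt0.
  move=> /near_lorentz_lt0/qcl[p [/PE/usP/(_ u uus)]].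
  by rewrite /= lorentzNl oppr_lt0 ltNge => ->.
split=> //; apply: contrapT => h; apply: qint.
suff : \forall p \near q, {in us, forall u, lorentz u (hval p) <= 0}.
  by apply: filterS => p /usP/PE.
have : {in us, forall u, u = 0 \/ lorentz u q < 0}.
  move=> u uus; have [->|uN0] := eqVneq u 0; [by left|right].
  rewrite lt_neqAle; move/usP : sq => -> //; rewrite andbT; apply/eqP => uq.
  apply: h; exists u; split => // w /cone_mem/usP; exact.
move: us {usP} => us; elim: us => [_|u us IH uP]; first by near=> p.
have uq := uP _ (mem_head _ _).
have /IH IH' : {in us, forall u, u = 0 \/ lorentz u q < 0}.
  by move=> w ws; apply: uP; rewrite inE ws orbT.
have : \forall p \near q, lorentz u (hval p) <= 0.
  case: uq => [->|/near_lorentz_lt0]; last by apply: filterS => p /ltW.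
  by near=> p; rewrite lorentz0l.
move: IH'; apply: filterS2 => p h1 h2 w; rewrite inE => /orP[/eqP ->//|].
exact: h1.
Unshelve. all: by end_near. Qed.

Lemma supported_boundary s P q u : generates s P -> cone s q -> u != 0 ->
  {in s, forall w, lorentz u w <= 0} -> lorentz u q = 0 -> boundary P q.
Proof.
move=> [_ PE] sq uN0 us uq; split; first by apply: subset_closure; apply/PE.
move=> /nbhs_separated/(_ uN0 uq)[p /PE sp].
by rewrite ltNge (cone_le0 us sp).
Qed.

(** If the generators spanned a proper subspace, the polytope would lie in a
hyperplane and have no interior. *)
Lemma interior_rank s P : generates s P -> P° !=set0 -> \rank (rows s) = n.+1.
Proof.
move=> [_ PE] [p pint]; apply/eqP; rewrite eqn_leq rank_leq_col leqNgt.
apply/negP => /exists_orthogonal[u uN0 us].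
have up q : P q -> lorentz u q = 0.
  by move=> /PE sq; apply: lorentz_rows us _; exact: cone_rows.
have [q Pq] := nbhs_separated pint uN0 (up _ (interior_subset pint)).
by rewrite up// ltxx.
Qed.

Lemma cvg_lorentz (T : Type) (F : set_system T) {FF : Filter F} u y (f : T -> 'rV[R]_n.+1) :
  (forall j, f t 0 j @[t --> F] --> y 0 j) -> lorentz u (f t) @[t --> F] --> lorentz u y.
Proof.
move=> fy; rewrite /lorentz; apply: cvgB; last first.
  by apply: cvgM; [exact: cvg_cst|exact: fy].
apply: cvg_big => [|i _]; first exact: add_continuous.
by apply: cvgM; [exact: cvg_cst|exact: fy].
Qed.

Lemma lorentz_continuous u : continuous (fun x => lorentz u x).
Proof. by move=> x; apply: (@cvg_lorentz _ (nbhs x)) => j; exact: coord_continuous. Qed.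

(** An ideal point of the cone is the limit, in the projective model, of the points
of the segment from [w] to [p] as they tend to [w]. *)
Lemma ideal_closure s P p w : generates s P -> P p -> ideal w -> cone s w ->
  closure [set (hval x 0 0)^-1 *: hval x | x in P] w.
Proof.
move=> [_ PE] /PE sp wid sw B Bw; have [ww w0] := wid.
have [fw _] := hyp_bar_future (or_intror wid : hyp_bar w).
pose f e := (1 + e * hval p 0 0)^-1 *: (w + e *: hval p).
have f0 : f 0 = w by rewrite /f mul0r addr0 scale0r addr0 invr1 scale1r.
have fw0 : f e @[e --> 0^'+] --> w.
  rewrite -f0; apply: cvg_at_right_filter; apply: cvgZ.
    apply: cvgV; first by rewrite mul0r addr0 oner_neq0.
    by apply: cvgD; [exact: cvg_cst|apply: cvgM; [exact: cvg_id|exact: cvg_cst]].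
  by apply: cvgD; [exact: cvg_cst|apply: cvgZ; [exact: cvg_id|exact: cvg_cst]].
have : \forall e \near 0^'+, B (f e) /\ 0 < e.
  by near=> e; split; near: e; [exact: fw0|exact: nbhs_right_gt].
move=> /filter_ex[e [Bf e0]].
have p0 := hyp_gt0 p.
have z0 : (w + e *: hval p) 0 0 = 1 + e * hval p 0 0 by rewrite !mxE w0.
have zz : lorentz (w + e *: hval p) (w + e *: hval p) < 0.
  rewrite !lorentz_rules lorentzxx ww (lorentzC p w).
  by have := lorentz_future fw (future_hyp p); nra.
have zpos : 0 < (w + e *: hval p) 0 0 by rewrite z0; nra.
have [t t0 [a aE]] := timelike_hyp zz zpos.
exists (f e); split => //; exists a.
  apply/PE; have -> : hval a = t^-1 *: (w + e *: hval p) by rewrite aE scalerK// gt_eqF.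
  by apply: coneZ; [rewrite invr_ge0 ltW|apply: coneD => //; exact/coneZ/sp/ltW].
rewrite /f -z0 aE mxE scalerA; congr (_ *: _).
by have a0 := hyp_gt0 a; field; rewrite !gt_eqF.
Unshelve. all: by end_near. Qed.

Lemma hyp_closureE s P : generates s P -> P !=set0 ->
  hyp_closure P = hyp_bar `&` cone s.
Proof.
move=> tP [p Pp]; have PE := tP.2; have [us usP] := cone_halfspaces s.
apply/seteqP; split=> x.
  case=> [[q qcl <-]|[xid xcl]].
    split; first by left; exact: hvalP.
    apply/PE; have [/interior_subset//|qint] := pselect (P° q).
    by apply/PE; have [] := boundary_supported tP (conj qcl qint).
  split; first by right.
  apply/usP => u uus; rewrite leNgt; apply/negP => ux.
  have : nbhs x [set y | 0 < lorentz u y].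
    by have := @lorentz_continuous u x; move/cvgr_gt => /(_ _ ux).
  move=> /xcl[_ [[q /PE/usP/(_ u uus) uq <-]]] /=.
  by rewrite lorentzZr pmulr_rgt0 ?invr_gt0 ?hyp_gt0// ltNge uq.
move=> [[xhyp|xid] sx]; last by right; split => //; exact: (ideal_closure tP Pp).
by left; exists (Hyp xhyp) => //; apply: subset_closure; apply/PE.
Qed.

(** The boundary is covered by the facets.  The hyperplane is spacelike because it
contains the point [q] of hyperbolic space itself. *)
Lemma facet_through s P q : generates s P -> P° !=set0 -> boundary P q -> exists u,
  [/\ 0 < lorentz u u, {in s, forall w, lorentz u w <= 0}, lorentz u q = 0 &
    facets P (hyp_closure P `&` [set x | lorentz u x = 0])].
Proof.
move=> tP Pint qbd; have rk := interior_rank tP Pint.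
have [sq [u0 [u0N0 u0s u0q]]] := boundary_supported tP qbd.
have [u [uN0 us uq urk]] := facet_hyperplane rk sq u0N0 u0s u0q.
have uu := orth_hyp_spacelike uN0 uq.
have clE : hyp_closure P = hyp_bar `&` cone s.
  by apply: hyp_closureE tP _; case: Pint => p /interior_subset; exists p.
exists u; split => //; split.
  by exists u; split => // x; rewrite clE => -[_]; exact: cone_le0.
set W := [seq w <- s | lorentz u w == 0] in urk.
suff [M [Mfree MW WM]] : exists M : 'M[R]_(\rank (rows W), n.+1),
    [/\ row_free M, forall i, row i M \in W & (rows W <= M)%MS].
  have n0 : \rank (rows W) = n.-1.+1.
    (* W is not empty: q is a nonzero element of its cone. *)
    rewrite prednK// -urk lt0n mxrank_eq0; apply/eqP => W0.
    have := cone_rows (cone_face us sq uq); rewrite -/W W0 => /submx0null q0.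
    by have := hyp_gt0 q; rewrite q0 mxE ltxx.
  rewrite /has_hdim -n0; exists M; split => // [i|x [+ ux]].
    have := MW i; rewrite mem_filter => /andP[/eqP uM Ms].
    by split => //; rewrite clE; split; [exact: tP.1|exact: cone_mem].
  rewrite clE => -[_ sx]; apply: submx_trans WM.
  exact/cone_rows/cone_face.
exists (rowsub (maxrankfun (rows W)) (rows W)); split.
- exact: maxrowsub_free.
- by move=> i; rewrite row_rowsub; exact: row_rows.
- by rewrite eq_maxrowsub.
Qed.

Lemma generator_vertex s P v : (2 <= n)%N -> generates s P -> P !=set0 ->
  v \in s -> ~ cone (rem v s) v -> vertices P v.
Proof.
move=> n2 tP P0 vs vrem; have [p _] := P0.
have [u [uu us uv uonly]] := exposed_generator n2 p tP.1 vs vrem.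
have vbar := tP.1 _ vs.
exists u; rewrite (hyp_closureE tP P0); split => // [x [_ /us//]|].
apply/seteqP; split=> [x -> |x [[xbar sx] /= ux]].
  by split => //; split => //; exact: cone_mem.
have [t xE] := uonly _ sx ux.
have [fx xN0] := hyp_bar_future xbar; have [fv vN0] := hyp_bar_future vbar.
have x0 := future_gt0 fx xN0; have v0 := future_gt0 fv vN0.
have t0 : 0 < t by move: x0; rewrite xE mxE pmulr_lgt0.
exact: hyp_bar_inj t0 xbar vbar xE.
Qed.

(** A face is determined by the generators that it contains; this is what makes the
numbers of vertices and of facets finite. *)
Lemma face_generated s P u : generates s P -> P !=set0 ->
  (forall x, hyp_closure P x -> lorentz u x <= 0) ->
  hyp_closure P `&` [set x | lorentz u x = 0] =
  hyp_bar `&` cone [seq w <- s | lorentz u w == 0].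
Proof.
move=> tP P0; rewrite (hyp_closureE tP P0) => ucl.
have us : {in s, forall w, lorentz u w <= 0}.
  by move=> w ws; apply: ucl; split; [exact: tP.1|exact: cone_mem].
apply/seteqP; split=> x.
  by move=> [[xbar sx] ux]; split => //; exact: cone_face.
move=> [xbar sx]; split.
  by split => //; apply: cone_sub sx => w; rewrite mem_filter => /andP[].
apply: (lorentz_rows _ (cone_rows sx)) => w.
by rewrite mem_filter => /andP[/eqP].
Qed.

Lemma vertices_sub s P : generates s P -> P !=set0 -> vertices P `<=` [set` s].
Proof.
move=> tP P0 v [u [uu ucl vE]]; have := vE; rewrite (face_generated tP P0 ucl) => sE.
have : (hyp_bar `&` cone [seq w <- s | lorentz u w == 0]) v by rewrite -sE.
move=> [vbar sv]; have [_ vN0] := hyp_bar_future vbar.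
case WE : [seq w <- s | lorentz u w == 0] sv sE => [|w W].
  by move=> v0; rewrite v0 eqxx in vN0.
have : w \in [seq w <- s | lorentz u w == 0] by rewrite WE mem_head.
rewrite mem_filter => /andP[_ ws] _ sE.
have <- : w = v; last by [].
suff : [set v] w by [].
by rewrite sE; split; [exact: tP.1|apply: cone_mem; exact: mem_head].
Qed.

Lemma finite_vertices s P : generates s P -> P !=set0 -> finite_set (vertices P).
Proof. by move=> tP P0; apply: sub_finite_set (vertices_sub tP P0) _. Qed.

Lemma finite_facets s P : generates s P -> P !=set0 -> finite_set (facets P).
Proof.
move=> tP P0.
pose G (m : (size s).-tuple bool) := hyp_bar `&` cone (mask m s).
apply: (@sub_finite_set _ _ (range G)); last exact/finite_image/finite_finset.
move=> F [[u [uu ucl ->]] _]; rewrite (face_generated tP P0 ucl).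
by exists [tuple of [seq lorentz u w == 0 | w <- in_tuple s]] => //;
  rewrite /G filter_mask.
Qed.

End generated_polytopes.

(** * Hausdorff distance *)

Section hausdorff.
Context {R : realType} {T : metricType R}.
Implicit Types A B : set T.

Lemma hausdorff_distanceC A B : hausdorff_distance A B = hausdorff_distance B A.
Proof. exact: maxC. Qed.

Lemma hausdorff_approx A B a t t' : (hausdorff_distance A B <= t%:E)%E ->
  t < t' -> A a -> exists2 b, B b & mdist a b < t'.
Proof.
move=> AB tt' Aa; have : (edist_inf B a < t'%:E)%E.
  apply: (@le_lt_trans _ _ t%:E); last by rewrite lte_fin.
  apply: le_trans AB; rewrite le_max; apply/orP; left.
  by apply: ereal_sup_ubound; exists a.
move=> /ereal_inf_lt[_ [b Bb <-]] /edist_lt_ball.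
by rewrite ballEmdist; exists b.
Qed.

End hausdorff.

(** * Caps *)

Section caps.
Context {R : realType} {n : nat} (x0 : hyp R n).
Implicit Types (v e u : 'rV[R]_n.+1) (d r : R) (q : hyp R n).

Definition direction v := lorentz v x0 = 0 /\ lorentz v v = 1.

(** The normal vector of the hyperplane at distance [d] from [x0] orthogonal to the
geodesic ray leaving [x0] in the direction [v].  The half-space beyond this
hyperplane, where [cap d v] is positive, will be called the cap of [v]. *)
Definition cap d v := sinh d *: hval x0 + cosh d *: v.

Lemma exists_direction u : u != 0 -> lorentz u x0 = 0 ->
  exists2 k, 0 < k & direction (k *: u).
Proof.
move=> uN0 ux; have uu := orth_hyp_spacelike uN0 ux.
have k0 : 0 < Num.sqrt (lorentz u u) by rewrite sqrtr_gt0.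
exists (Num.sqrt (lorentz u u))^-1; first by rewrite invr_gt0.
split; rewrite !lorentz_rules ?ux ?mulr0//.
by rewrite -[X in _ * (_ * X)](sqr_sqrtr (ltW uu)); field; rewrite gt_eqF.
Qed.

Lemma orthogonal_directions : (2 <= n)%N -> exists v v',
  [/\ direction v, direction v' & lorentz v v' = 0].
Proof.
move=> n2; have [|u uN0 uP] := @exists_orthogonal _ _ [:: hval x0].
  by apply: leq_trans (rank_leq_row _) _; exact: ltnW.
have [k k0 kd] := exists_direction uN0 (uP _ (mem_head _ _)).
have [|u' u'N0 u'P] := @exists_orthogonal _ _ [:: hval x0; k *: u].
  exact: leq_trans (rank_leq_row _) _.
have [k' k'0 k'd] := exists_direction u'N0 (u'P _ (mem_head _ _)).
exists (k *: u), (k' *: u'); split => //.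
by rewrite lorentzC lorentzZl u'P ?mulr0// !inE eqxx orbT.
Qed.

Lemma exists_geodesic_point v t : direction v ->
  exists q, hval q = cosh t *: hval x0 + sinh t *: v.
Proof.
move=> [vx vv]; set x := (X in exists q, hval q = X).
have xx : lorentz x x = -1.
  rewrite !lorentz_rules vx vv lorentzxx (lorentzC x0 v) vx.
  by rewrite -[in RHS](cosh2Bsinh2 t); ring.
have xx0 : lorentz x x0 = - cosh t by rewrite !lorentz_rules vx lorentzxx; ring.
have H : hyperboloid x.
  rewrite /hyperboloid xx eqxx; apply: (@timelike_future _ _ x0).
    by rewrite xx; lra.
  by rewrite xx0 oppr_lt0 divr_gt0// addr_gt0 ?expR_gt0.
by exists (Hyp H).
Qed.

(** The centre [q'] of the ball lies on the ray at distance [r - d] beyond the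
hyperplane, so that [q' = cosh (r - d) f + sinh (r - d) (cap d v)] with [f] the foot
of the perpendicular.  Since [1 <= - lorentz f q], a point [q] closer to [q']
than [r - d] pairs positively with [cap d v]. *)
Lemma ball_sub_cap v d r q q' : direction v -> d < r ->
  hval q' = cosh r *: hval x0 + sinh r *: v ->
  - lorentz q' q < cosh (r - d) -> 0 < lorentz (cap d v) q.
Proof.
move=> dv dr q'E q'q; have [f fE] := exists_geodesic_point d dv.
have rd : 0 < sinh (r - d) by apply: sinh_gt0; lra.
have {}q'E : hval q' = cosh (r - d) *: hval f + sinh (r - d) *: cap d v.
  rewrite q'E fE /cap coshB sinhB; apply/rowP => j; rewrite !mxE.
  rewrite -[cosh r in LHS]mulr1 -[sinh r in LHS]mulr1 -(cosh2Bsinh2 d).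
  by ring.
move: q'q; rewrite q'E lorentzDl !lorentzZl => q'q.
have := lorentz_hyp_ge1 f q.
have : 1 < cosh (r - d) by apply: cosh_gt1; lra.
by rewrite -(pmulr_rgt0 _ rd); nra.
Qed.

(** For directions far enough apart the sum of the two normals is a timelike future
vector, which cannot pair positively with a future vector. *)
Lemma caps_disjoint v v' d x : direction v -> direction v' -> 0 < d ->
  2 < cosh d ^+ 2 * (1 - lorentz v v') -> future x ->
  0 < lorentz (cap d v) x -> lorentz (cap d v') x <= 0.
Proof.
move=> [vx vv] [v'x v'v'] d0 far fx vpos; rewrite leNgt; apply/negP => v'pos.
pose w := cap d v + cap d v'.
have ww : lorentz w w < 0.
  have -> : lorentz w w =
      - 4 * sinh d ^+ 2 + cosh d ^+ 2 * (2 + 2 * lorentz v v').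
    rewrite /w /cap !lorentz_rules lorentzxx !(lorentzC x0) vx v'x vv v'v'.
    by rewrite (lorentzC v' v); ring.
  by have := cosh2Bsinh2 d; nra.
have wx : lorentz w x0 < 0.
  rewrite /w /cap !lorentz_rules lorentzxx vx v'x; have := sinh_gt0 d0; lra.
have fw : future w by split; apply: ltW => //; exact: timelike_future ww wx.
by have := lorentz_future fw fx; rewrite /w lorentzDl; lra.
Qed.

(** Seen from [x0] a cap is small.  In the projective model centred at [x0] the point
[q] is at [p = k q - x0], in the unit ball, and being in the cap means that
[lorentz p v] exceeds [sinh d / cosh d].  Hence [p - v] has square at most
[2 (1 - sinh d / cosh d)], which is at most [2 / cosh d ^ 2]. *)
Lemma cap_shadow v e d q : direction v -> direction e -> 0 < lorentz (cap d v) q ->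
  0 <= d ->
  `|cosh d * lorentz ((- lorentz q x0)^-1 *: hval q - hval x0 - v) e| <= 3 / 2.
Proof.
move=> [vx vv] [ex ee] vq d0; set k := (- lorentz q x0)^-1.
have qx := lorentz_hyp_ge1 q x0.
have k0 : 0 < k by rewrite invr_gt0; lra.
have kq : k * lorentz q x0 = -1.
  by rewrite /k invrN mulNr mulVf// lt_eqF//; lra.
set p := k *: hval q - hval x0.
have px : lorentz p x0 = 0.
  by rewrite /p !lorentz_rules kq lorentzxx; ring.
have pp : lorentz p p <= 1.
  have -> : lorentz p p = - k ^+ 2 - 2 * (k * lorentz q x0) - 1.
    by rewrite /p !lorentz_rules !lorentzxx (lorentzC x0 q); ring.
  by rewrite kq; have := sqr_ge0 k; lra.
have qE : k *: hval q = p + hval x0 by rewrite subrK.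
clearbody p.
have pv : sinh d < cosh d * lorentz p v.
  have : 0 < lorentz (cap d v) (k *: hval q) by rewrite lorentzZr mulr_gt0.
  rewrite /cap qE.
  rewrite !lorentz_rules vx lorentzxx (lorentzC x0 p) px (lorentzC v p).
  lra.
have pvx : lorentz (p - v) x0 = 0 by rewrite !lorentz_rules px vx subrr.
have := lorentz_orth_CS pvx ex; rewrite ee mulr1 => CS.
have {}CS : lorentz (p - v) e ^+ 2 <= 2 - 2 * lorentz p v.
  apply: le_trans CS _; rewrite !lorentz_rules vv (lorentzC v p); lra.
set al := lorentz _ e in CS *.
have C1 : 1 <= cosh d.
  by move: d0; rewrite le_eqVlt => /orP[/eqP <-|/cosh_gt1/ltW//]; rewrite cosh0.
have S0 : 0 <= sinh d.
  by move: d0; rewrite le_eqVlt => /orP[/eqP <-|/sinh_gt0/ltW//]; rewrite sinh0.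
have CS1 := cosh2Bsinh2 d.
rewrite -ler_sqr ?nnegrE ?divr_ge0//.
rewrite real_normK ?num_real// exprMn.
have h1 : cosh d ^+ 2 * al ^+ 2 <= cosh d * (2 * (cosh d - lorentz p v * cosh d)).
  have -> : cosh d * (2 * (cosh d - lorentz p v * cosh d)) =
    cosh d ^+ 2 * (2 - 2 * lorentz p v) by ring.
  by apply: ler_wpM2l CS; exact: sqr_ge0.
have h2 : cosh d * (cosh d - lorentz p v * cosh d) <= cosh d * (cosh d - sinh d).
  by rewrite ler_wpM2l//; lra.
have h3 : cosh d * (cosh d - sinh d) <= 1.
  have : 0 <= cosh d - sinh d by rewrite subr_ge0 -ler_sqr ?nnegrE//; lra.
  by nra.
lra.
Qed.

End caps.

Section facet_separation.
Context {R : realType} {n : nat} (x0 : hyp R n).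
Implicit Types (v e u : 'rV[R]_n.+1) (q : hyp R n) (P : set (hyp R n)).

(** A supporting hyperplane cannot meet two caps of distant directions at points of
the polytope.  The segment joining these points would lie in the hyperplane,
hence in the boundary, while its midpoint in the projective model centred at [x0]
is within [d] of [x0]: by [cap_shadow] the two points [p], [p'] of the unit ball
are at distance at least [2 / cosh d], and the parallelogram identity makes
[p + p'] short. *)
Lemma facet_meets_one_cap s P d u q q' v v' e : generates s P -> 0 <= d ->
  (forall b, boundary P b -> cosh d < - lorentz x0 b) ->
  u != 0 -> {in s, forall w, lorentz u w <= 0} ->
  P q -> P q' -> lorentz u q = 0 -> lorentz u q' = 0 ->
  direction x0 v -> direction x0 v' -> direction x0 e ->
  0 < lorentz (cap x0 d v) q -> 0 < lorentz (cap x0 d v') q' ->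
  cosh d * (lorentz v e - lorentz v' e) < 5.
Proof.
move=> tP d0 far uN0 us /tP.2 sq /tP.2 sq' uq uq' dv dv' de vq v'q'.
rewrite ltNge; apply/negP => h5.
have h1 := cap_shadow dv de vq d0; have h2 := cap_shadow dv' de v'q' d0.
have qx := lorentz_hyp_ge1 q x0; have q'x := lorentz_hyp_ge1 q' x0.
set k := (- lorentz q x0)^-1 in h1; set k' := (- lorentz q' x0)^-1 in h2.
have k0 : 0 < k by rewrite invr_gt0; lra.
have k'0 : 0 < k' by rewrite invr_gt0; lra.
have kq : k * lorentz q x0 = -1.
  by rewrite /k invrN mulNr mulVf// lt_eqF//; lra.
have k'q' : k' * lorentz q' x0 = -1.
  by rewrite /k' invrN mulNr mulVf// lt_eqF//; lra.
(* twice the midpoint of the two points, in the projective model *)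
pose m := k *: hval q + k' *: hval q'.
have fm : future m by apply: futureD; apply: futureZ; rewrite ?ltW//; exact: future_hyp.
have mx : lorentz m x0 = -2 by rewrite /m !lorentz_rules kq k'q'; ring.
have mm : 4 <= cosh d ^+ 2 * - lorentz m m.
  set D := lorentz (k *: hval q - k' *: hval q') e.
  have CD : 2 <= cosh d * D.
    have -> : cosh d * D = cosh d * lorentz (k *: hval q - hval x0 - v) e
       - cosh d * lorentz (k' *: hval q' - hval x0 - v') e
       + cosh d * (lorentz v e - lorentz v' e).
      by rewrite /D !lorentz_rules; ring.
    by move: h1 h2; rewrite !ler_norml => /andP[? ?] /andP[? ?]; lra.
  have qq'x : lorentz (k *: hval q - k' *: hval q') x0 = 0.
    by rewrite !lorentz_rules kq k'q' subrr.
  have := lorentz_orth_CS qq'x de.1; rewrite -/D de.2 mulr1 => CS.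
  have {}CS : D ^+ 2 <= - lorentz m m.
    apply: le_trans CS _.
    rewrite /m !lorentz_rules !lorentzxx (lorentzC q' q).
    by have := sqr_ge0 k; have := sqr_ge0 k'; lra.
  apply: (@le_trans _ _ ((cosh d * D) ^+ 2)); first by nra.
  by rewrite exprMn ler_wpM2l// sqr_ge0.
have m0 : 0 < m 0 0.
  apply: future_gt0 => //; apply/eqP => m0.
  by move: mx; rewrite m0 lorentz0l; lra.
have mm0 : lorentz m m < 0.
  rewrite ltNge; apply/negP => mm0; have := fm.2 => mm1.
  have mmE : lorentz m m = 0 by lra.
  by move: mm; rewrite mmE; lra.
have [t t0 [b bE]] := timelike_hyp mm0 m0.
have sb : cone s b.
  have -> : hval b = t^-1 *: m by rewrite bE scalerK// gt_eqF.
  apply: coneZ; first by rewrite invr_ge0 ltW.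
  by apply: coneD; apply: coneZ => //; exact: ltW.
have ub : lorentz u b = 0.
  have : lorentz u m = 0 by rewrite /m !lorentz_rules uq uq'; ring.
  by rewrite bE lorentzZr => /eqP; rewrite mulf_eq0 gt_eqF// => /eqP.
have := far _ (supported_boundary tP sb uN0 us ub).
have t2 : - lorentz m m = t ^+ 2 by rewrite bE !lorentz_rules lorentzxx; ring.
have tb : t * - lorentz x0 b = 2.
  by move: mx; rewrite bE lorentzZl (lorentzC b); lra.
move=> Cb; rewrite t2 -exprMn in mm.
have Ct : cosh d * t < 2 by rewrite -tb mulrC ltr_pM2l.
have C0 : 0 < cosh d by rewrite divr_gt0// addr_gt0 ?expR_gt0.
have : 0 < cosh d * t by exact: mulr_gt0.
by nra.
Qed.

End facet_separation.

(** * Cardinals and the choice of the exponent *)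

Section counting.

Lemma card_of_ge (T : choiceType) (A : set T) (N : nat) (f : 'I_N -> T) :
  finite_set A -> (forall i, A (f i)) ->
  (forall i j : 'I_N, (j < i)%N -> f i <> f j) -> (N <= card_of A)%N.
Proof.
move=> Afin Af fneq.
have finj : injective f.
  move=> i j fij; case: (ltngtP i j) => [/fneq|/fneq|]; last exact: val_inj.
    by move=> /(_ (esym fij)).
  by move=> /(_ fij).
rewrite /card_of -[N in (N <= _)%N]card_ord.
have <- : #|` [fset f i | i in 'I_N]%fset| = #|'I_N|.
  by rewrite card_imfset//= -cardE.
apply: fsubset_leq_card; apply/fsubsetP => _ /imfsetP[i _ ->].
by rewrite in_fset_set// inE.
Qed.

Lemma card_of_ge2 (T : choiceType) (A : set T) x y :
  finite_set A -> A x -> A y -> x <> y -> (2 <= card_of A)%N.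
Proof.
move=> Afin Ax Ay /eqP xy.
have <- : #|` [fset x; y]%fset| = 2%N by rewrite cardfs2 xy.
by apply: fsubset_leq_card; apply/fsubsetP => z; rewrite !inE => /orP[] /eqP ->;
  rewrite in_fset_set// inE.
Qed.

(** The assumption [2 <= m] absorbs all constants: with [N] the integer part of
[cosh d / 5] one gets [expR d <= 2 cosh d <= 10 (m + 1) <= 16 m <= m ^ 5]. *)
Lemma expR_le_count (R : realType) (d : R) (m : nat) : (2 <= m)%N -> 0 <= d ->
  (forall N, 5 * N%:R <= cosh d -> (N <= m)%N) -> expR (d / 5) <= m%:R.
Proof.
move=> m2 d0 mP; have m2' : 2 <= m%:R :> R by rewrite ler_nat.
have C0 : 0 <= cosh d / 5 by rewrite divr_ge0// divr_ge0// addr_ge0 ?expR_ge0.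
have /andP[N1 N2] := truncn_itv C0.
have {}N1 : (Num.truncn (cosh d / 5) <= m)%N by apply: mP; lra.
have hm : cosh d / 5 < m%:R + 1.
  by apply: lt_le_trans N2 _; rewrite -natr1 lerD2r ler_nat.
have e15 : expR d <= 16 * m%:R.
  have : expR d <= 2 * cosh d.
    by rewrite /cosh mulrCA divff// mulr1 lerDl expR_ge0.
  lra.
have e5 : expR (d / 5) ^+ 5 <= m%:R ^+ 5.
  rewrite -expRM_natl mulrCA divff// mulr1; apply: le_trans e15 _.
  rewrite [in leRHS]exprSr ler_wpM2r ?ler0n//.
  by rewrite (_ : 16 = 2 ^+ 4 :> R) ?lerXn2r ?nnegrE//; ring.
by move: e5; rewrite ler_pXn2r ?nnegrE ?expR_ge0 ?ler0n.
Qed.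

End counting.

(** * The caps around a sphere close to the boundary *)

Section boundary_near_sphere.
Context {R : realType} {n : nat}.
Implicit Types (b : hyp R n) (P : set (hyp R n)) (r rho d : R).

Lemma boundary_far (x0 : hyp R n) P r rho d b : 0 <= d -> d < r - rho ->
  (hausdorff_distance (boundary P) (sphere x0 r) <= rho%:E)%E ->
  boundary P b -> cosh d < - lorentz x0 b.
Proof.
move=> d0 dr near_sphere; have rhod : rho < r - d by lra.
move=> /(hausdorff_approx near_sphere rhod)[y x0y by_].
have := metric_triangle x0 b y; rewrite x0y => tri.
by rewrite -cosh_hdist cosh_lt//; lra.
Qed.

(** The point of the sphere in the direction [v] is at distance [r - d] from the
bounding hyperplane of the cap, and some boundary point is closer to it than
that. *)
Lemma cap_meets_boundary (x0 : hyp R n) P r rho d v : 0 <= rho -> 0 <= r -> d < r - rho ->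
  (hausdorff_distance (boundary P) (sphere x0 r) <= rho%:E)%E ->
  direction x0 v -> exists2 q, boundary P q & 0 < lorentz (cap x0 d v) q.
Proof.
move=> rho0 r0 dr near_sphere dv; have [y yE] := exists_geodesic_point r dv.
have Sy : sphere x0 r y.
  have xy0 : 0 <= mdist x0 y by exact/arcosh_ge0/lorentz_hyp_ge1.
  have coshxy : cosh (mdist x0 y) = cosh r.
    rewrite cosh_hdist yE !lorentz_rules lorentzxx (lorentzC x0 v) dv.1; ring.
  rewrite /sphere /=; case: (ltgtP (mdist x0 y) r) => // h.
    by have := cosh_lt xy0 h; rewrite coshxy ltxx.
  by have := cosh_lt r0 h; rewrite coshxy ltxx.
move: near_sphere; rewrite hausdorff_distanceC => near_boundary.
have [|q Bq yq] := hausdorff_approx (t' := r - d) near_boundary _ Sy; first by lra.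
exists q => //; apply: ball_sub_cap dv _ yE _; first by lra.
by rewrite -hdist_lt//; lra.
Qed.

End boundary_near_sphere.

(** * Counting vertices and facets *)

Section lower_bounds.
Context {R : realType} {n : nat} (x0 : hyp R n).
Implicit Types (v e u : 'rV[R]_n.+1) (d : R).

Lemma direction_opp v : direction x0 v -> direction x0 (- v).
Proof. by move=> [vx vv]; split; rewrite !lorentz_rules ?vx ?vv ?oppr0 ?opprK. Qed.

(** On a quarter of the unit circle, abscissas [i / N] already separate [N]
directions enough. *)
Lemma separated_directions N : (2 <= n)%N -> exists e (v : 'I_N -> 'rV[R]_n.+1),
  [/\ direction x0 e, forall i, direction x0 (v i) & forall i j : 'I_N, (j < i)%N ->
    N%:R^-1 <= lorentz (v i) e - lorentz (v j) e].
Proof.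
move=> n2; have [e [e' [de de' ee']]] := orthogonal_directions x0 n2.
pose a (i : 'I_N) : R := i%:R / N%:R.
exists e, (fun i => a i *: e + Num.sqrt (1 - a i ^+ 2) *: e'); split => // [i|i j ji].
  have N0 : 0 < N%:R :> R by rewrite ltr0n; case: (N) i => // -[].
  have a0 : 0 <= a i by rewrite divr_ge0 ?ler0n.
  have a1 : a i <= 1 by rewrite ler_pdivrMr// mul1r ler_nat ltnW.
  have s2 : Num.sqrt (1 - a i ^+ 2) ^+ 2 = 1 - a i ^+ 2 by rewrite sqr_sqrtr//; nra.
  split; rewrite !lorentz_rules ?de.1 ?de'.1; first by ring.
  rewrite (lorentzC e' e) ee' de.2 de'.2 !mulr0 addr0 add0r !mulr1 -!expr2 s2; ring.
rewrite !lorentz_rules (lorentzC e' e) ee' de.2 !mulr0 !addr0 !mulr1 /a -mulrBl.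
rewrite ler_peMl ?invr_ge0 ?ler0n// -natrB ?(ltnW ji)// ler1n subn_gt0//.
Qed.

(** Each cap contains a point of the polytope, hence one of its generators, which is
a vertex; disjoint caps give different vertices.  Two opposite caps are disjoint
for every positive [d]. *)
Lemma vertices_lower_bounds P r rho d : (2 <= n)%N -> convex_polytope P ->
  0 <= rho -> 0 < d -> d < r - rho ->
  (hausdorff_distance (boundary P) (sphere x0 r) <= rho%:E)%E ->
  (2 <= card_of (vertices P))%N /\
  forall N, 5 * N%:R <= cosh d -> (N <= card_of (vertices P))%N.
Proof.
move=> n2 polP rho0 d0 dr hd; have [s [tP irr]] := polytope_generators polP.
have P0 : P !=set0 by have [[p /interior_subset Pp] _] := polP; exists p.
have vfin := finite_vertices tP P0.
have capv v : direction x0 v -> exists w,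
    [/\ vertices P w, future w & 0 < lorentz (cap x0 d v) w].
  move=> dv.
  have r0 : 0 <= r by lra.
  have [q Bq vq] := cap_meets_boundary rho0 r0 dr hd dv.
  have [w ws vw] := cone_gt0 (boundary_supported tP Bq).1 vq.
  exists w; split => //; first exact: generator_vertex n2 tP P0 ws (irr _ ws).
  by have [] := hyp_bar_future (tP.1 _ ws).
have C1 := cosh_gt1 d0.
split.
  have [e [_ [de _ _]]] := orthogonal_directions x0 n2.
  have [w [Vw fw ew]] := capv _ de; have [w' [Vw' _ ew']] := capv _ (direction_opp de).
  apply: (card_of_ge2 vfin Vw Vw') => ww'; move: ew'; rewrite -ww'.
  apply/negP; rewrite -leNgt.
  apply: (caps_disjoint de (direction_opp de) d0 _ fw ew).
  by rewrite !lorentz_rules de.2; nra.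
move=> N NC; have [e [v [de dv vsep]]] := separated_directions N n2.
have [f fP] := choice (fun i => capv _ (dv i)).
apply: (card_of_ge (f := f)) => // [i|i j ji fij]; first by have [] := fP i.
have [_ fi vi] := fP i; have [_ _] := fP j; rewrite -fij.
apply/negP; rewrite -leNgt; apply: (caps_disjoint (dv i) (dv j) d0 _ fi vi).
have N0 : 0 < N%:R :> R by rewrite ltr0n; case: (N) i {fij fi vi ji} => // -[].
have h := vsep _ _ ji.
have h5 : 5 <= cosh d * (lorentz (v i) e - lorentz (v j) e).
  apply: le_trans (ler_wpM2l (ltW (lt_trans ltr01 C1)) h).
  by rewrite ler_pdivlMr.
have vx : lorentz (v i - v j) x0 = 0 by rewrite !lorentz_rules (dv i).1 (dv j).1 subrr.
have := lorentz_orth_CS vx de.1; rewrite de.2 mulr1.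
rewrite !lorentz_rules (dv i).2 (dv j).2 (lorentzC (v j) (v i)) => CS.
have := ler_wpM2l (sqr_ge0 (cosh d)) CS; rewrite -exprMn; nra.
Qed.

(** Each cap contains a boundary point, which lies on a facet, and one facet cannot
serve two caps of distant directions.  For small [d] this may give a single
facet; a second one is found in the half-space through [x0] that faces away from
the hyperplane of the first. *)
Lemma facets_lower_bounds P r rho d : (2 <= n)%N -> convex_polytope P ->
  0 <= rho -> 0 < d -> d < r - rho ->
  (hausdorff_distance (boundary P) (sphere x0 r) <= rho%:E)%E ->
  (2 <= card_of (facets P))%N /\
  forall N, 5 * N%:R <= cosh d -> (N <= card_of (facets P))%N.
Proof.
move=> n2 polP rho0 d0 dr hd; have [s [tP irr]] := polytope_generators polP.
have [Pint _] := polP.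
have P0 : P !=set0 by have [p /interior_subset] := Pint; exists p.
have ffin := finite_facets tP P0.
pose facet u := hyp_closure P `&` [set x | lorentz u x = 0].
have bdP q : boundary P q -> P q by move=> /(boundary_supported tP)[/tP.2].
have facetP u q : boundary P q -> lorentz u q = 0 -> facet u q.
  by move=> [qcl _] uq; split => //; left; exists q.
have capf d' v : d' <= d -> direction x0 v -> exists qu : hyp R n * 'rV[R]_n.+1,
    [/\ boundary P qu.1 /\ 0 < lorentz (cap x0 d' v) qu.1, 0 < lorentz qu.2 qu.2,
      {in s, forall w, lorentz qu.2 w <= 0}, lorentz qu.2 qu.1 = 0 & facets P (facet qu.2)].
  move=> d'd dv.
  have r0 : 0 <= r by lra.
  have d'r : d' < r - rho by lra.
  have [q Bq vq] := cap_meets_boundary rho0 r0 d'r hd dv.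
  by have [u [uu us uq uF]] := facet_through tP Pint Bq; exists (q, u).
have neq0 u : 0 < lorentz u u -> u != 0.
  by move=> uu; apply/eqP => u0; move: uu; rewrite u0 lorentz0l ltxx.
split.
  have [e [_ [de _ _]]] := orthogonal_directions x0 n2.
  have [[q u] /= [[Bq _] uu us uq uF]] := capf d e (lexx d) de.
  pose z := u + lorentz u x0 *: hval x0.
  have zx : lorentz z x0 = 0 by rewrite !lorentz_rules lorentzxx; ring.
  have zz : lorentz z z = lorentz u u + lorentz u x0 ^+ 2.
    by rewrite !lorentz_rules lorentzxx (lorentzC x0 u); ring.
  have zN0 : z != 0 by apply: neq0; rewrite zz; have := sqr_ge0 (lorentz u x0); lra.
  have [k k0 dz] := exists_direction zN0 zx.
  (* k z is the unit direction of u seen from x0.  In the half-space through x0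
     where k z has the sign of lorentz u x0 (negative if that is 0), both terms
     of lorentz u in the decomposition uE below have this sign. *)
  have [q' [u' [Bq' u'q' u'F uq']]] : exists q' u', [/\ boundary P q',
      lorentz u' q' = 0, facets P (facet u') & lorentz u q' != 0].
    have cap0 v : direction x0 v -> exists q' u', [/\ boundary P q', lorentz u' q' = 0,
        facets P (facet u') & 0 < lorentz v q'].
      move=> dv; have [[q' u'] /= [[Bq' vq'] _ _ u'q' u'F]] := capf 0 v (ltW d0) dv.
      by exists q', u'; split => //; move: vq'; rewrite /cap sinh0 cosh0 scale0r add0r scale1r.
    have uE (q' : hyp R n) : lorentz u q' =
        k^-1 * lorentz (k *: z) q' - lorentz u x0 * lorentz x0 q'.
      by rewrite lorentzZl mulrA mulVf ?gt_eqF// /z !lorentz_rules; ring.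
    have ki : 0 < k^-1 by rewrite invr_gt0.
    have [ux|ux] := leP (lorentz u x0) 0.
      have [q' [u' [? ? ? h]]] := cap0 _ (direction_opp dz).
      exists q', u'; split => //; rewrite uE lt_eqF//.
      have := lorentz_hyp_ge1 x0 q'; move: h; rewrite lorentzNl.
      set L := lorentz (k *: z) q'; set X := lorentz x0 q' => h X1.
      have kL : k^-1 * L < 0 by rewrite pmulr_rlt0//; lra.
      by nra.
    have [q' [u' [? ? ? h]]] := cap0 _ dz.
    exists q', u'; split => //; rewrite uE gt_eqF//.
    have := lorentz_hyp_ge1 x0 q'; move: h.
    set L := lorentz (k *: z) q'; set X := lorentz x0 q' => h X1.
    have kL : 0 < k^-1 * L by rewrite pmulr_rgt0.
    by nra.
  apply: (card_of_ge2 ffin uF u'F) => FF.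
  have [_ /= uq'0] : facet u q' by rewrite FF; exact: facetP.
  by rewrite uq'0 eqxx in uq'.
move=> N NC; have [e [v [de dv vsep]]] := separated_directions N n2.
have [f fP] := choice (fun i => capf d _ (lexx d) (dv i)).
apply: (card_of_ge (f := fun i => facet (f i).2)) => // [i|i j ji fij]; first by have [] := fP i.
have [[Bi vi] uu us ui _] := fP i; have [[Bj vj] _ _ uj _] := fP j.
have [_ /= uij] : facet (f i).2 (f j).1 by rewrite fij; exact: facetP.
have := facet_meets_one_cap tP (ltW d0) (fun b => boundary_far (ltW d0) dr hd (b := b))
  (neq0 _ uu) us (bdP _ Bi) (bdP _ Bj) ui uij (dv i) (dv j) de vi vj.
have N0 : 0 < N%:R :> R by rewrite ltr0n; case: (N) i {fij ji Bi vi uu us ui uij} => // -[].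
apply/negP; rewrite -leNgt.
apply: le_trans (ler_wpM2l (ltW (lt_trans ltr01 (cosh_gt1 d0))) (vsep _ _ ji)).
by rewrite ler_pdivlMr.
Qed.

End lower_bounds.

Theorem corollary6p4 (R : realType) (n : nat) (c : R) :
  (2 <= n)%N -> 0 < c -> c < 1 ->
  exists2 kappa : R, 0 < kappa &
    forall (r : R) (x0 : hyp R n) (P : set (hyp R n)),
      0 < r ->
      convex_polytope P ->
      (hausdorff_distance (boundary P) (sphere x0 r) <= (c * r)%:E)%E ->
      expR (kappa * r) <= (card_of (vertices P))%:R /\
      expR (kappa * r) <= (card_of (facets P))%:R.
Proof.
move=> n2 c0 c1; exists ((1 - c) / 10); first by rewrite divr_gt0//; lra.
move=> r x0 P r0 polP hd.
(* any fixed fraction of r - c r would do, with another kappa *)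
pose d := (1 - c) * r / 2.
have rho0 : 0 <= c * r by rewrite mulr_ge0// ltW.
have d0 : 0 < d by rewrite divr_gt0// mulr_gt0//; lra.
have dr : d < r - c * r by rewrite /d in d0 *; lra.
have -> : (1 - c) / 10 * r = d / 5 by rewrite /d; field.
have [V2 VN] := vertices_lower_bounds n2 polP rho0 d0 dr hd.
have [F2 FN] := facets_lower_bounds n2 polP rho0 d0 dr hd.
by split; apply: expR_le_count => //; exact: ltW.
Qed.
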